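(* Let $D$ be a $2$-dimensional regular local ring and let $V$ be a minimal valuation overring of $D$. Then there exists a subset $\mathcal{U}$ of $Q(D)$ such that $V$ is a localization of $C=\bigcap_{\alpha\in\mathcal{U}}\alpha$. In particular, if $V$ is not a DVR, then $C$ is not an almost Krull domain.
   Context: $Q(D)$ denotes the set of all $2$-dimensional regular local rings $\alpha$ with $D\subseteq\alpha\subseteq F$, $F$ the quotient field of $D$. A valuation overring of $D$ is a valuation ring $V$ with $D\subseteq V\subseteq F$; it is minimal if it is minimal with respect to inclusion among valuation overrings of $D$. An integral domain $C$ is an almost Krull domain if $C_P$ is a Krull domain for every prime ideal $P$ of $C$. *)

(* Defs.v *)
From HB Require Import structures.
From mathcomp Require Import all_boot all_order all_algebra.
From Stdlib Require List.
Set Implicit Arguments. Unset Strict Implicit. Unset Printing Implicit Defensive.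
Import Order.TTheory GRing.Theory Num.Theory.
Local Open Scope ring_scope.

Section CommAlg.
Variable F : fieldType.
Implicit Types (A B I P M S : F -> Prop).

Definition subset_of A B := forall x, A x -> B x.
Definition same A B := forall x, A x <-> B x.

Definition subring A :=
  [/\ A 0, A 1, (forall x y, A x -> A y -> A (x - y)) &
      (forall x y, A x -> A y -> A (x * y))].

Definition has_quotient_field A :=
  forall x, exists a b, [/\ A a, A b, b != 0 & x = a / b].

Definition ideal A I :=
  [/\ subset_of I A, I 0, (forall x y, I x -> I y -> I (x + y)) &
      (forall a x, A a -> I x -> I (a * x))].

Definition proper_ideal A I := ideal A I /\ ~ I 1.

Definition prime_ideal A P :=
  proper_ideal A P /\ (forall a b, A a -> A b -> P (a * b) -> P a \/ P b).

Definition maximal_ideal A M :=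
  proper_ideal A M /\
  (forall N, proper_ideal A N -> subset_of M N -> same N M).

Definition gen_ideal A (s : seq F) (x : F) :=
  exists c : nat -> F, (forall i, A (c i)) /\ x = \sum_(i < size s) c i * s`_i.

Definition fin_gen A I :=
  exists s : seq F, (forall i, (i < size s)%N -> A s`_i) /\
                    same I (gen_ideal A s).

Definition noetherian A := forall I, ideal A I -> fin_gen A I.

Definition local_ring A :=
  exists M, maximal_ideal A M /\ forall N, maximal_ideal A N -> same N M.

Definition strict_sub A B := subset_of A B /\ ~ subset_of B A.

Definition krull_dim2 A :=
  (exists P0 P1 P2, [/\ prime_ideal A P0, prime_ideal A P1, prime_ideal A P2,
                        strict_sub P0 P1 & strict_sub P1 P2]) /\
  ~ (exists P0 P1 P2 P3, [/\ prime_ideal A P0, prime_ideal A P1,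
        prime_ideal A P2, prime_ideal A P3 &
        [/\ strict_sub P0 P1, strict_sub P1 P2 & strict_sub P2 P3]]).

Definition min_num_gens A I (n : nat) :=
  (exists s : seq F, [/\ size s = n, (forall i, (i < size s)%N -> A s`_i) &
                         same I (gen_ideal A s)]) /\
  (forall s : seq F, (size s < n)%N -> (forall i, (i < size s)%N -> A s`_i) ->
                     ~ same I (gen_ideal A s)).

Definition regular_local_dim2 A :=
  [/\ subring A, noetherian A, krull_dim2 A &
      exists M, [/\ maximal_ideal A M,
                    (forall N, maximal_ideal A N -> same N M) &
                    min_num_gens A M 2]].

Definition QD D alpha := subset_of D alpha /\ regular_local_dim2 alpha.

Definition valuation_ring V :=
  subring V /\ forall x, x != 0 -> V x \/ V x^-1.

Definition valuation_overring D V := valuation_ring V /\ subset_of D V.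

Definition minimal_valuation_overring D V :=
  valuation_overring D V /\
  forall W, valuation_overring D W -> subset_of W V -> subset_of V W.

(* discrete (rank one) valuation ring of F: the valuation ring of a
   surjective valuation v : F^* -> Z *)
Definition DVR V :=
  exists v : F -> int,
  [/\ (forall x y, x != 0 -> y != 0 -> v (x * y) = v x + v y),
      (forall x y, x != 0 -> y != 0 -> x + y != 0 ->
                   Num.min (v x) (v y) <= v (x + y)),
      (exists x, x != 0 /\ v x = 1) &
      (forall x, V x <-> (x = 0 \/ 0 <= v x))].

Definition krull_domain A :=
  exists (I : Type) (W : I -> F -> Prop),
  [/\ (forall i, DVR (W i)),
      (forall x, A x <-> forall i, W i x) &
      (forall x, x != 0 -> exists s : seq I,
         forall i, ~ (W i x /\ W i x^-1) -> List.In i s)].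

Definition mult_subset C S :=
  [/\ subset_of S C, S 1, ~ S 0 & (forall s t, S s -> S t -> S (s * t))].

Definition locz C S (x : F) := exists c s, [/\ C c, S s & x = c / s].

Definition is_localization_of C V :=
  exists S, mult_subset C S /\ same V (locz C S).

Definition almost_krull C :=
  forall P, prime_ideal C P -> krull_domain (locz C (fun x => C x /\ ~ P x)).

End CommAlg.

(* Main.v *)
From mathcomp Require Import all_boot all_order all_algebra.
From mathcomp Require Import boolp ring zify.
From mathcomp Require classical_sets.
Require Import Defs.
Set Implicit Arguments. Unset Strict Implicit. Unset Printing Implicit Defensive.
Import Order.TTheory GRing.Theory Num.Theory.
Local Open Scope ring_scope.

(** Chevalley's extension theorem shows that a minimal valuation overring V is
    centered on a maximal ideal of every ring between D and V.  Hence V determines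
    an infinite sequence of local quadratic transforms D = A_0 < A_1 < ..., and
    V is their union: if f = a/b, the transforms I_n of the primary ideal (a, b)
    pull back to an ascending chain of ideals of D which is strict as long as
    I_n is proper, so I_n = A_n, i.e. f or 1/f lies in A_n, for some n.

    The generators x, y of the maximal ideal of A_n can be chosen so that t = x/y
    is a unit of V; then A_{n+1} is the localization of A_n[t] at the center
    of V, and alpha_n is the localization of A_n[t] at (y, t).  Each A_n is the
    localization at the center of V of a ring R_n, with R_0 = D and
    R_{n+1} = R_n[t].  Perturbing x and y by an element e of R_n which is
    congruent to 1 modulo the maximal ideal of V and is a nonunit of
    alpha_0, ..., alpha_{n-1} makes t a nonunit of all of these, so that
    R_{n+1} is contained in every alpha_i.  Then C contains every R_n, whence
    V = C_P with P the center of V; conversely C is contained in V since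
    alpha_n dominates A_n.  A valuation ring that is a Krull domain is a DVR,
    which gives the last assertion. *)

(** * Subrings, ideals and Noetherian rings *)

(** The obstacle is that the rings A_n do not lie in the earlier alpha_i: the element t used at
    stage i is a unit of V, so 1/t lies in A_{i+1}, while t is a nonunit of alpha_i. Hence V can be
    recovered from C only through numerators and denominators taken in rings that are not localized.
    This is the role of the R_n, and the reason why x and y are chosen inside R_n with y invertible
    in every earlier alpha_i. Minimality of V is used through the maximality of its centers. It
    makes the center on A_n[t] strictly larger than the extension of the maximal ideal of A_n, so
    that A_{n+1} is again two-dimensional and regular; and it gives an inverse f of t modulo the
    maximal ideal of V, so that the next e can be t f. Regularity is carried as a pair (x, y)
    generating the ideal of nonunits, with y a nonzerodivisor modulo x. This form is checked after a
    blow-up by computing with polynomials in t; Krull dimension appears only when passing from and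
    to the given definition. *)

Section Subrings.
Variable F : fieldType.
Implicit Types (A B I J K N V : F -> Prop).

Lemma sr0 A : subring A -> A 0. Proof. by case. Qed.
Lemma sr1 A : subring A -> A 1. Proof. by case. Qed.
Lemma srB A a b : subring A -> A a -> A b -> A (a - b).
Proof. by case=> _ _ h _; exact: h. Qed.
Lemma srM A a b : subring A -> A a -> A b -> A (a * b).
Proof. by case=> _ _ _ h; exact: h. Qed.
Lemma srN A a : subring A -> A a -> A (- a).
Proof. by move=> sA Aa; rewrite -sub0r; apply: srB => //; exact: sr0. Qed.
Lemma srD A a b : subring A -> A a -> A b -> A (a + b).
Proof. by move=> sA Aa Ab; rewrite -[b]opprK; apply: srB => //; exact: srN. Qed.
Lemma srX A a n : subring A -> A a -> A (a ^+ n).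
Proof.
by move=> sA Aa; elim: n => [|n IH]; rewrite ?expr0 ?exprS; [exact: sr1|exact: srM].
Qed.

Lemma idD A I a b : ideal A I -> I a -> I b -> I (a + b).
Proof. by case=> _ _ h _; exact: h. Qed.
Lemma idMl A I a b : ideal A I -> A a -> I b -> I (a * b).
Proof. by case=> _ _ _ h; exact: h. Qed.
Lemma idMr A I a b : ideal A I -> I a -> A b -> I (a * b).
Proof. by rewrite mulrC => iI Ia Ab; exact: idMl iI _ _. Qed.
Lemma id0 A I : ideal A I -> I 0. Proof. by case. Qed.
Lemma idS A I a : ideal A I -> I a -> A a. Proof. by case=> h _ _ _; exact: h. Qed.
Lemma idB A I a b : subring A -> ideal A I -> I a -> I b -> I (a - b).
Proof.
move=> sA iI Ia Ib; apply: (idD iI) => //; rewrite -mulN1r; apply: (idMl iI) => //.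
by apply: srN => //; exact: sr1.
Qed.

End Subrings.

Ltac inr :=
  repeat first [ assumption | apply: sr0 | apply: sr1 | apply: srD | apply: srB
    | apply: srN | apply: srM | apply: srX ].

Section Noetherian.
Variable F : fieldType.
Implicit Types (A B I J K N V : F -> Prop).

(** Recursive form of [gen_ideal], suited to induction on the list of generators. *)
Fixpoint comb A (s : seq F) (z : F) : Prop :=
  if s is g :: s' then exists a z', [/\ A a, comb A s' z' & z = a * g + z']
  else z = 0.

Lemma gen_idealE A s z : A 0 -> gen_ideal A s z <-> comb A s z.
Proof.
move=> A0; elim: s z => [|g s IH] z /=.
  split=> [[c [_ ->]]|->]; first by rewrite big_ord0.
  by exists (fun=> 0); split=> //; rewrite big_ord0.
split=> [[c [Ac ->]]|[a [z' [Aa /IH [c [Ac ->]] ->]]]].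
  rewrite big_ord_recl /=; exists (c 0%N), (\sum_(i < size s) c i.+1 * s`_i).
  by split=> //; apply/IH; exists (fun i => c i.+1).
exists (fun i => if i is i'.+1 then c i' else a); split; first by case.
by rewrite big_ord_recl.
Qed.

Lemma comb_ideal A I s z : ideal A I -> (forall g, g \in s -> I g) ->
  comb A s z -> I z.
Proof.
move=> iI; elim: s z => [|g s IH] z sI /=; first by move=> ->; exact: (id0 iI).
case=> a [z' [Aa cz ->]]; apply: (idD iI).
  by apply: (idMl iI) => //; apply: sI; rewrite mem_head.
by apply: IH cz => h hs; apply: sI; rewrite in_cons hs orbT.
Qed.

Lemma comb0 A s : subring A -> comb A s 0.
Proof.
move=> sA; elim: s => //= g s IH; exists 0, 0; split=> //; first exact: sr0.
by rewrite mul0r addr0.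
Qed.

Lemma combD A s z w : subring A -> comb A s z -> comb A s w -> comb A s (z + w).
Proof.
move=> sA; elim: s z w => [|g s IH] z w /=; first by move=> -> ->; rewrite addr0.
case=> a [z' [Aa cz ->]] [b [w' [Ab cw ->]]]; exists (a + b), (z' + w').
split; [by inr | exact: IH | by ring].
Qed.

Lemma combM A s a z : subring A -> A a -> comb A s z -> comb A s (a * z).
Proof.
move=> sA Aa; elim: s z => [|g s IH] z /=; first by move=> ->; rewrite mulr0.
case=> b [z' [Ab cz ->]]; exists (a * b), (a * z').
split; [by inr | exact: IH | by ring].
Qed.

Lemma comb_mem A s g : subring A -> g \in s -> comb A s g.
Proof.
move=> sA; elim: s => //= h s IH; rewrite in_cons => /orP[/eqP<-|/IH c].
  by exists 1, 0; split; [inr | exact: comb0 | ring].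
by exists 0, g; split=> //; [inr | ring].
Qed.

Lemma comb_catl A s s' z : subring A -> comb A s z -> comb A (s ++ s') z.
Proof.
move=> sA; elim: s z => [|g s IH] z /=; first by move=> ->; exact: comb0.
by case=> a [z' [Aa /IH cz ->]]; exists a, z'.
Qed.

Lemma comb_catr A s s' z : subring A -> comb A s' z -> comb A (s ++ s') z.
Proof.
move=> sA; elim: s => [|g s IH] //= /IH c; exists 0, z.
by split; [inr | | ring].
Qed.

Lemma comb_sub A B s z : subset_of A B -> comb A s z -> comb B s z.
Proof.
move=> AB; elim: s z => [|g s IH] z //= [a [z' [Aa /IH cz ->]]].
by exists a, z'; split=> //; exact: AB.
Qed.

Lemma fin_genE A I : subring A -> ideal A I ->
  fin_gen A I <-> exists s, (forall g, g \in s -> I g) /\ (forall z, I z -> comb A s z).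
Proof.
move=> sA iI; have A0 := sr0 sA; split.
  case=> s [sS sI]; exists s; split=> [g gs|z /sI /(gen_idealE _ _ A0) //].
  by apply/sI/gen_idealE => //; exact: comb_mem.
case=> s [sI Is]; exists s; split=> [i lt_i|z].
  by apply: (idS iI); apply: sI; exact: mem_nth.
rewrite (gen_idealE _ _ A0); split; first exact: Is.
exact: comb_ideal.
Qed.

(** Without a maximal member, choice gives a strictly ascending chain in [Fam]; finitely many
    generators of its union all lie in one term, which then contains the next one. *)
Lemma noeth_max A (Fam : (F -> Prop) -> Prop) : subring A -> noetherian A ->
  (forall I, Fam I -> ideal A I) -> (exists I, Fam I) ->
  exists I, Fam I /\ forall J, Fam J -> subset_of I J -> subset_of J I.
Proof.
move=> sA nA FamI [I0 FI0]; apply: contrapT => nomax.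
have next (I : {I | Fam I}) : exists J : {I | Fam I}, strict_sub (sval I) (sval J).
  case: I => I FI /=; apply: contrapT => nx; apply: nomax; exists I; split=> // J FJ IJ.
  by apply: contrapT => nJI; apply: nx; exists (exist _ J FJ).
case: (choice next) => nx nxP.
pose I n := sval (iter n nx (exist _ I0 FI0)).
have FI n : Fam (I n) by rewrite /I; case: (iter _ _ _).
have IS n : strict_sub (I n) (I n.+1) by exact: nxP.
have Imono n m z : (n <= m)%N -> I n z -> I m z.
  move=> /subnKC <-; elim: (m - n)%N => [|k IH]; rewrite ?addn0 ?addnS // => h.
  by apply: (proj1 (IS _)); exact: IH.
pose U z := exists n, I n z.
have iU : ideal A U.
  split; first by move=> z [n /(idS (FamI _ (FI n)))].
  - by exists 0%N; exact: id0 (FamI _ (FI 0%N)).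
  - move=> a b [n na] [m mb]; exists (maxn n m).
    apply: (idD (FamI _ (FI _))); first exact: Imono (leq_maxl _ _) na.
    exact: Imono (leq_maxr _ _) mb.
  - by move=> a z Aa [n nz]; exists n; exact: (idMl (FamI _ (FI n))).
have /(fin_genE sA iU) [s [sU Us]] := nA _ iU.
have [m mP] : exists m, forall g, g \in s -> I m g.
  elim: s sU {Us} => [|g s IH] sU; first by exists 0%N.
  have [m mP] := IH (fun h hs => sU h (mem_behead (s := g :: s) hs)).
  have [n ng] := sU g (mem_head _ _); exists (maxn n m) => h.
  rewrite in_cons => /orP[/eqP->|/mP]; first exact: Imono (leq_maxl _ _) ng.
  exact: Imono (leq_maxr _ _).
have [_ []] := IS m => z Iz; apply: (comb_ideal (FamI _ (FI m)) mP).
by apply: Us; exists m.+1.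
Qed.

Definition iadd A I (c z : F) := exists i a, [/\ I i, A a & z = i + c * a].

Lemma iadd_ideal A I c : subring A -> ideal A I -> A c -> ideal A (iadd A I c).
Proof.
move=> sA iI Ac; split.
- by move=> z [i [a [/(idS iI) Ai Aa ->]]]; inr.
- by exists 0, 0; split; [exact: id0 iI | inr | ring].
- move=> z w [i [a [Ii Aa ->]]] [j [b [Ij Ab ->]]]; exists (i + j), (a + b).
  by split; [exact: (idD iI) | inr | ring].
- move=> b z Ab [i [a [Ii Aa ->]]]; exists (b * i), (b * a).
  by split; [exact: (idMl iI) | inr | ring].
Qed.

Lemma iaddl A I c : subring A -> subset_of I (iadd A I c).
Proof. by move=> sA i Ii; exists i, 0; split=> //; [inr | ring]. Qed.

Lemma iaddr A I c a : subring A -> ideal A I -> A a -> iadd A I c (c * a).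
Proof. by move=> sA iI Aa; exists 0, a; split=> //; [exact: id0 iI | ring]. Qed.

(* Instead of inducting on generators of K, take L maximal among the ideals
   containing G but not K: then K is generated by one element modulo L. *)
Lemma nakayama A G K x : subring A -> noetherian A -> A x ->
  (forall a, A a -> 1 - x * a != 0 /\ A (1 - x * a)^-1) ->
  ideal A G -> ideal A K ->
  (forall k, K k -> exists g k', [/\ G g, K k' & k = g + x * k']) ->
  subset_of K G.
Proof.
move=> sA nA Ax xu iG iK KG; apply: contrapT => nKG.
pose Fam L := [/\ ideal A L, subset_of G L & ~ subset_of K L].
have [L [[iL GL nKL] Lmax]] : exists L, Fam L /\ forall J, Fam J -> subset_of L J -> subset_of J L.
  by apply: (noeth_max sA nA); [by move=> I [] | exists G; split].
apply: nKL => k Kk; apply: contrapT => nLk.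
have Ak := idS iK Kk.
have iLk := iadd_ideal sA iL Ak.
have KLk : subset_of K (iadd A L k).
  apply: contrapT => nK; apply: nLk; apply: (Lmax (iadd A L k)).
  - by split=> // g /GL; exact: iaddl.
  - exact: iaddl.
  - by exists 0, 1; split; [exact: id0 iL | inr | ring].
have [g [k' [Gg Kk' kE]]] := KG _ Kk; have [l [a [Ll Aa k'E]]] := KLk _ Kk'.
have [u0 Au] := xu _ Aa; apply: nLk.
have -> : k = (1 - x * a)^-1 * (g + x * l).
  have e : k * (1 - x * a) = g + x * l by rewrite mulrBr mulr1 {1}kE k'E; ring.
  by rewrite -e mulrCA mulVf ?mulr1.
by apply: (idMl iL) => //; apply: (idD iL); [exact: GL | exact: (idMl iL)].
Qed.

End Noetherian.

(** * Two-dimensional regular local rings *)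

Lemma nat_minP (P : nat -> Prop) : (exists n, P n) ->
  exists n, P n /\ forall m, P m -> (n <= m)%N.
Proof.
move=> exP; have exb : exists n, `[< P n >] by case: exP => n Pn; exists n; exact/asboolP.
by case: (ex_minnP exb) => n /asboolP Pn nmin; exists n; split=> // m /asboolP /nmin.
Qed.

Section RegularLocal.
Variable F : fieldType.
Implicit Types (A B I J K M P V : F -> Prop).

(** Since [0^-1 = 0] in a [fieldType], the inverse of 0 lies in A; concluding [c = 0] instead of
    falsity keeps 0 among the nonunits. *)
Definition nonunit A (c : F) := A c /\ (A c^-1 -> c = 0).

Lemma nonunit0 A : subring A -> nonunit A 0.
Proof. by move=> sA; split=> //; inr. Qed.

Lemma nonunit1 A : subring A -> ~ nonunit A 1.
Proof. by move=> sA []; rewrite invr1 => A1 /(_ A1) /eqP; rewrite oner_eq0. Qed.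

Lemma nonunitM A a b : subring A -> nonunit A a -> A b -> nonunit A (a * b).
Proof.
move=> sA [Aa na] Ab; split=> [|Ai]; first by inr.
have [//|ab0] := eqVneq (a * b) 0.
have [a0 b0] : a != 0 /\ b != 0 by apply/andP; rewrite -negb_or -mulf_eq0.
suff /na a00 : A a^-1 by rewrite a00 eqxx in a0.
have -> : a^-1 = b * (a * b)^-1 by field; rewrite a0 b0.
by inr.
Qed.

Lemma unitP A c : A c -> ~ nonunit A c -> c != 0 /\ A c^-1.
Proof.
move=> Ac nc; have Ai : A c^-1 by apply: contrapT => nA; apply: nc; split.
by split=> //; apply/eqP => c0; apply: nc; split.
Qed.

Lemma unitPn A c : c != 0 -> A c^-1 -> ~ nonunit A c.
Proof. by move=> c0 Ai [_ /(_ Ai) /eqP]; rewrite (negPf c0). Qed.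

(** Locality is contained in [l2_m]: nonunits form an ideal, namely the one generated by x and y. *)
Record loc2 A (x y : F) : Prop := Loc2 {
  l2_sub : subring A;
  l2_noeth : noetherian A;
  l2_x : A x;
  l2_y : A y;
  l2_m : forall c, nonunit A c <-> exists a b, [/\ A a, A b & c = a * x + b * y] }.

(** Together with [rl_x0], [rl_reg] says that (x, y) is a regular sequence; this stands in for
    dimension two and regularity. *)
Record rlsp A (x y : F) : Prop := Rlsp {
  rl_loc2 :> loc2 A x y;
  rl_x0 : x != 0;
  rl_reg : forall c d, A c -> A d -> y * c = x * d -> exists2 e, A e & c = x * e }.

Definition pid A (x z : F) := exists2 a, A a & z = x * a.

Lemma pid_ideal A x : subring A -> A x -> ideal A (pid A x).
Proof.
move=> sA Ax; split.
- by move=> z [a Aa ->]; inr.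
- by exists 0; [inr | ring].
- by move=> z w [a Aa ->] [b Ab ->]; exists (a + b); [inr | ring].
- by move=> b z Ab [a Aa ->]; exists (b * a); [inr | ring].
Qed.

Section Loc2.
Variables (A : F -> Prop) (x y : F).
Hypothesis l2 : loc2 A x y.
Let sA := l2_sub l2.
Let nA := l2_noeth l2.
Let Ax := l2_x l2.
Let Ay := l2_y l2.

Lemma nonunitD a b : nonunit A a -> nonunit A b -> nonunit A (a + b).
Proof.
move=> /(l2_m l2)[a1 [a2 [? ? ->]]] /(l2_m l2)[b1 [b2 [? ? ->]]].
by apply/(l2_m l2); exists (a1 + b1), (a2 + b2); split; [inr | inr | ring].
Qed.

Lemma nonunitx : nonunit A x.
Proof. by apply/(l2_m l2); exists 1, 0; split; [inr | inr | ring]. Qed.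

Lemma nonunity : nonunit A y.
Proof. by apply/(l2_m l2); exists 0, 1; split; [inr | inr | ring]. Qed.

Lemma unit1B z a : nonunit A z -> A a -> 1 - z * a != 0 /\ A (1 - z * a)^-1.
Proof.
move=> nz Aa; have Az : A z by case: nz.
apply: unitP; first by inr.
move=> n1; apply: (nonunit1 sA); have -> : 1 = 1 - z * a + z * a by rewrite subrK.
by apply: nonunitD => //; exact: nonunitM.
Qed.

(** The quotient A/xA behaves like a discrete valuation ring with uniformizer y, though it is not
    yet known to be a domain. Powers of y are extracted from c until the ideal (x, d) of the
    cofactor d is maximal. If d = a x + b y were still a nonunit, b would lie in (x, d), so d (1 - y
    l) would lie in xA for some l, with 1 - y l a unit. *)
Lemma dvr_mod c : A c -> ~ pid A x c ->
  exists u e h, [/\ u != 0, A u, A u^-1, A h & c = u * y ^+ e + x * h].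
Proof.
move=> Ac xc; pose ix := pid_ideal sA Ax.
pose Q d := [/\ A d, ~ pid A x d & exists n h, A h /\ c = y ^+ n * d + x * h].
pose Fam I := exists2 d, Q d & I = iadd A (pid A x) d.
have [||_ [[d [Ad xd [n [h [Ah cE]]]] ->] dmax]] := @noeth_max _ A Fam sA nA.
- by move=> I [d [Ad _ _] ->]; exact: iadd_ideal.
- exists (iadd A (pid A x) c), c => //; split=> //.
  by exists 0%N, 0; split; [inr | rewrite expr0; ring].
have [nd|] := EM (nonunit A d); last first.
  move=> /(unitP Ad)[d0 Ai]; exists d, n, h; split=> //.
  by rewrite cE; ring.
case/(l2_m l2): (nd) => a [b [Aa Ab dE]].
have xb : ~ pid A x b.
  by case=> b' Ab' bE; apply: xd; exists (a + b' * y); [inr | rewrite dE bE; ring].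
have db : iadd A (pid A x) b d.
  exists (x * a), y; split=> //; first by exists a.
  by rewrite dE; ring.
have [|z [i [a' [[i' Ai' ->] Aa' ->]]]||_ [l [[k Ak ->] Al bE]]] := dmax (iadd A (pid A x) b) _ _ b _.
- exists b => //; split=> //; exists n.+1, (h + y ^+ n * a); split; first by inr.
  by rewrite cE dE exprS; ring.
- have ib := iadd_ideal sA ix Ab; apply: (idD ib); last exact: (idMr ib).
  by apply: iaddl => //; exists i'.
- by exists 0, 1; split; [exact: id0 ix | inr | ring].
have [u0 Au] := unit1B nonunity Al.
case: xd; exists ((a + y * k) * (1 - y * l)^-1); first by inr.
apply: (mulIf u0); rewrite mulrA mulfVK //; rewrite mulrBr mulr1 {1}dE bE; ring.
Qed.

(** A generator is an element g of K with the least exponent of y modulo x. Every k in K is a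
    multiple of g modulo x, and by saturation the remainder is x times an element of K, so Nakayama
    applies. *)
Lemma sat_principal K : ideal A K -> (forall c, A c -> K (x * c) -> K c) ->
  exists2 g, K g & forall c, K c -> pid A g c.
Proof.
move=> iK sat.
have nak := fun G => @nakayama _ A G K x sA nA Ax (fun a => @unit1B x a nonunitx).
have [Kx|nKx] := EM (forall c, K c -> pid A x c).
  (* If K lies in xA, saturation gives K = xK, hence K = 0. *)
  exists 0; first exact: id0 iK.
  apply: nak => //; first by apply: pid_ideal; inr.
  move=> k Kk; have [k' Ak' kE] := Kx _ Kk; exists 0, k'.
  split; [by exists 0; [inr | ring] | by apply: sat; rewrite // -kE | by rewrite kE; ring].
pose P e := exists g u h, [/\ K g, u != 0 /\ A u, A u^-1, A h & g = u * y ^+ e + x * h].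
have [|e [[g [u [h [Kg [u0 Au] Aui Ah gE]]]] emin]] := @nat_minP P.
  have /existsNP[c /not_implyP[Kc /(dvr_mod (idS iK Kc))[u [e [h [? ? ? ? cE]]]]]] := nKx.
  by exists e, c, u, h; split.
have Ag := idS iK Kg.
exists g => //; apply: nak => //; first exact: pid_ideal.
move=> k Kk; have Ak := idS iK Kk; have [[k' Ak' kE]|nx] := EM (pid A x k).
  exists 0, k'; split; [by exists 0; [inr | ring] | by apply: sat; rewrite // -kE | by rewrite kE; ring].
have [v [f [h' [v0 Av Avi Ah' kE]]]] := dvr_mod Ak nx.
have le_ef : (e <= f)%N by apply: emin; exists k, v, h'.
pose w := v * u^-1 * y ^+ (f - e).
have Aw : A w by rewrite /w; inr.
have xk : x * (h' - w * h) = k - g * w.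
  have -> : k - g * w = v * y ^+ f - v * (u * u^-1) * (y ^+ (f - e) * y ^+ e) + x * (h' - w * h).
    by rewrite kE {1}gE /w; ring.
  by rewrite -exprD subnK // divff // mulr1 subrr add0r.
exists (g * w), (h' - w * h); split.
- by exists w.
- apply: sat; first by inr.
  by rewrite xk; apply: (idB sA iK) => //; exact: (idMr iK).
- by rewrite xk; ring.
Qed.

End Loc2.

(** A nonunit c generates a proper ideal, which the maximum condition places in a maximal ideal; by
    uniqueness this is M. *)
Lemma nonunit_maximal A M : subring A -> noetherian A -> maximal_ideal A M ->
  (forall N, maximal_ideal A N -> same N M) -> same (nonunit A) M.
Proof.
move=> sA nA [[iM M1] Mmax] Muniq c; split; last first.
  move=> Mc; split=> [|Aci]; first exact: (idS iM).
  apply/eqP; apply: contrapT => /negP c0; apply: M1; rewrite -(divff c0).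
  exact: (idMr iM).
move=> [Ac nc]; apply: contrapT => nMc.
have c1 : ~ pid A c 1.
  case=> a Aa /esym ca; have c0 : c != 0 by apply/eqP => c0; move/eqP: ca; rewrite c0 mul0r eq_sym oner_eq0.
  have /nc : A c^-1 by rewrite -[c^-1]mulr1 -ca mulKf.
  by move/eqP; rewrite (negPf c0).
pose Fam I := proper_ideal A I /\ subset_of (pid A c) I.
have [||I [[pI cI] Imax]] := @noeth_max _ A Fam sA nA.
- by move=> I [[]].
- by exists (pid A c); split=> //; split=> //; exact: pid_ideal.
apply: nMc; apply/(Muniq I).
  split=> // N pN IN z; split; last exact: IN.
  by apply: (Imax N) => //; split=> // w /cI /IN.
by apply: cI; exists 1; [inr | ring].
Qed.

Lemma proper_nonunit A I c : proper_ideal A I -> I c -> nonunit A c.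
Proof.
move=> [iI I1] Ic; split=> [|Aci]; first exact: (idS iI).
apply/eqP; apply: contrapT => /negP c0; apply: I1; rewrite -(divff c0).
exact: (idMr iI).
Qed.

Lemma regular_loc2 A : regular_local_dim2 A -> exists x y, loc2 A x y.
Proof.
case=> sA nA _ [M [mM uM [[s [ss sS sM]] _]]].
have e := nonunit_maximal sA nA mM uM.
case: s ss sS sM => [|x [|y []]] // _ sS sM; exists x, y; split=> //.
- by have := sS 0%N isT.
- by have := sS 1%N isT.
- move=> c; rewrite (e c) (sM c) (gen_idealE _ _ (sr0 sA)) /=; split.
    by move=> [a [_ [Aa [b [_ [Ab -> ->]]] ->]]]; exists a, b; rewrite addr0.
  by move=> [a [b [Aa Ab ->]]]; exists a, (b * y); split=> //; exists b, 0; rewrite addr0.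
Qed.

(** * From Krull dimension two to a regular sequence *)

Section DimTwo.
Variables (A : F -> Prop) (x y : F).
Hypothesis l2 : loc2 A x y.
Let sA := l2_sub l2.
Let nA := l2_noeth l2.
Let Ax := l2_x l2.
Let Ay := l2_y l2.

(* Krull's principal ideal theorem in the case at hand: if y is nilpotent
   modulo x then the symbolic powers of g stabilise modulo x, hence stabilise,
   for every g in a prime P not containing x. *)
Lemma y_not_nilpotent P e : prime_ideal A P -> (exists2 g, g != 0 & P g) ->
  strict_sub P (nonunit A) -> ~ pid A x (y ^+ e).
Proof.
move=> [[iP P1] Pp] [g g0 Pg] [_ nMP] xye.
have Ag := idS iP Pg.
have px z n : A z -> P (z ^+ n) -> P z.
  move=> Az; elim: n => [|n IH]; first by rewrite expr0.
  by rewrite exprS => /(Pp _ _ Az (srX n sA Az))[|/IH].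
have nPx : ~ P x.
  move=> Px; apply: nMP => c /(l2_m l2)[a [b [Aa Ab ->]]].
  apply: (idD iP); apply: (idMl iP) => //; apply: (px _ e) => //.
  by case: xye => a' Aa' ->; exact: (idMr iP).
(* [K n] is the contraction to A of the ideal generated by g^n in the localization at P; it is
   saturated with respect to x because x is outside P. *)
pose K n c := A c /\ exists s d, [/\ A s, ~ P s, A d & s * c = g ^+ n * d].
have iK n : ideal A (K n).
  split; first by move=> z [].
  - by split; [inr | exists 1, 0; split; [inr | | inr | ring]].
  - move=> a b [Aa [s [d [As Ps Ad sE]]]] [Ab [s' [d' [As' Ps' Ad' sE']]]].
    split; first by inr.
    exists (s * s'), (s' * d + s * d'); split; [by inr | by case/Pp | by inr |].
    have -> : s * s' * (a + b) = s' * (s * a) + s * (s' * b) by ring.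
    by rewrite sE sE'; ring.
  - move=> a b Aa [Ab [s [d [As Ps Ad sE]]]]; split; first by inr.
    by exists s, (a * d); split=> //; [inr | rewrite mulrCA sE; ring].
have Ksat n c : A c -> K n (x * c) -> K n c.
  move=> Ac [_ [s [d [As Ps Ad sE]]]]; split=> //; exists (s * x), d.
  by split=> //; [inr | case/Pp | rewrite -mulrA].
have KS n c : K n.+1 c -> K n c.
  move=> [Ac [s [d [As Ps Ad sE]]]]; split=> //; exists s, (g * d).
  by split=> //; [inr | rewrite sE exprS; ring].
(* If this failed for all n, then by induction no y^i with i < n would lie in K n + xA: an element
   of K n outside K (n+1) + xA is a unit times y^f modulo x, with f at least n. But y^e lies in
   xA. *)
have [n Kn] : exists n, subset_of (K n) (iadd A (K n.+1) x).
  apply: contrapT => /forallNP nK.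
  have h n : forall i, (i < n)%N -> ~ iadd A (K n) x (y ^+ i).
    elim: n => // n IH i; rewrite ltnS => le_in ki.
    have /existsNP[c /not_implyP[Kc nc]] := nK n; have Ac := idS (iK n) Kc.
    have i1 := iadd_ideal sA (iK n.+1) Ax.
    have [|u [f [h [u0 Au Aui Ah cE]]]] := dvr_mod l2 Ac.
      by case=> a Aa ca; apply: nc; rewrite ca; apply: iaddr => //.
    have fE : y ^+ f = u^-1 * c - u^-1 * x * h.
      by rewrite cE mulrDr mulKf // mulrA; ring.
    have le_nf : (n <= f)%N.
      rewrite leqNgt; apply/negP => /IH; apply; exists (u^-1 * c), (- (u^-1 * h)).
      by split; [exact: (idMl (iK n)) | inr | rewrite fE; ring].
    apply: nc; rewrite cE; apply: (idD i1); last exact: iaddr.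
    apply: (idMl i1) => //; rewrite -(subnK (leq_trans le_in le_nf)) exprD.
    by apply: (idMl i1) => //; inr.
  apply: (h e.+1 e) => //; case: xye => a Aa ->; exact: iaddr.
(* By saturation K n = K (n+1) + x K n, so Nakayama applies. Evaluated at g^n, the inclusion gives s
   outside P with s = g d, which is absurd. *)
have KK : subset_of (K n) (K n.+1).
  apply: (nakayama sA nA Ax (fun a => @unit1B A x y l2 x a (nonunitx l2))) => //.
  move=> k Kk; have [i [a [Ki Aa kE]]] := Kn _ Kk; exists i, a; split=> //.
  apply: Ksat => //; have -> : x * a = k - i by rewrite kE; ring.
  by apply: (idB sA (iK n)) => //; exact: KS.
have [|_ [s [d [As Ps Ad sE]]]] := KK (g ^+ n).
  by split; [inr | exists 1, 1; split; [inr | | inr | ring]].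
apply: Ps; have -> : s = g * d.
  by apply: (mulIf (expf_neq0 n g0)); rewrite sE exprS; ring.
exact: (idMr iP).
Qed.

End DimTwo.

(** If x were 0, one generator would suffice. The middle prime of a chain of length two feeds
    [y_not_nilpotent]; a relation y c = x d with c = u y^f + x h outside xA would put y^(f+1) into
    xA. *)
Lemma regular_rlsp A x y : regular_local_dim2 A -> loc2 A x y -> rlsp A x y.
Proof.
move=> [sA nA [[P0 [P1 [P2 [prP0 prP1 prP2 s01 s12]]]] _] [M [mM uM [_ Mmin]]]] l2.
have e := nonunit_maximal sA nA mM uM.
have Ax := l2_x l2; have Ay := l2_y l2.
have x0 : x != 0.
  apply/eqP => x0; apply: (Mmin [:: y]) => // [[]//|c].
  rewrite -(e c) (l2_m l2) (gen_idealE _ _ (sr0 sA)) /=; split.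
    by move=> [a [b [Aa Ab ->]]]; exists b, 0; rewrite x0 addr0 mulr0 add0r.
  by move=> [a [_ [Aa -> ->]]]; exists 0, a; split; [inr | | ring].
have nil f : ~ pid A x (y ^+ f).
  apply: (@y_not_nilpotent A x y l2 P1 f prP1).
    case: s01 => _ /existsNP[g /not_implyP[Pg nPg]]; exists g => //.
    by apply/eqP => g0; apply: nPg; rewrite g0; case: prP0 => [[/id0]].
  case: s12 => s12 ns12; split.
    by move=> c; case: prP1 => h _; exact: proper_nonunit h.
  by move=> MP; apply: ns12 => c; case: prP2 => h _ /(proper_nonunit h) /MP.
split=> // c d Ac Ad ycd; have [[a Aa ->]|/(dvr_mod l2 Ac)] := EM (pid A x c).
  by exists a.
move=> [u [f [h [u0 Au Aui Ah cE]]]]; case: (nil f.+1).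
exists (u^-1 * (d - y * h)); first by inr.
apply: (mulfI u0); have -> : x * (u^-1 * (d - y * h)) = u^-1 * (x * d - y * (x * h)) by ring.
by rewrite mulVKf // -ycd cE exprS; ring.
Qed.

End RegularLocal.

Section RegularLocalDim2.
Variable F : fieldType.
Implicit Types (A B I J K M P V : F -> Prop).

Lemma loc2_sym A x y : loc2 A x y -> loc2 A y x.
Proof.
case=> sA nA Ax Ay m; split=> // c; rewrite m.
by split=> -[a [b [Aa Ab ->]]]; exists b, a; rewrite addrC.
Qed.

Lemma rl_y0 A x y : rlsp A x y -> y != 0.
Proof.
move=> r; have sA := l2_sub r; apply/eqP => y0.
have [|e Ae e1] := @rl_reg _ _ _ _ r 1 0 (sr1 sA) (sr0 sA); first by rewrite y0; ring.
apply: (nonunit1 sA); rewrite e1; exact: nonunitM sA (nonunitx r) Ae.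
Qed.

Lemma rl_y_nilp A x y n : rlsp A x y -> ~ pid A x (y ^+ n).
Proof.
move=> r; have sA := l2_sub r; have Ay := l2_y r; elim: n => [|n IH] [a Aa].
  rewrite expr0 => e; apply: (nonunit1 sA); rewrite e; exact: nonunitM sA (nonunitx r) Aa.
rewrite exprS => /(rl_reg r (srX n sA Ay) Aa)[e Ae E]; apply: IH; by exists e.
Qed.

(** Such a prime misses x or y, and being prime it is saturated with respect to the one it
    misses. *)
Lemma prime_principal A x y P : rlsp A x y -> prime_ideal A P ->
  ~ subset_of (nonunit A) P -> exists2 g, P g & forall c, P c -> pid A g c.
Proof.
move=> r [[iP P1] Pp] nMP; have Ax := l2_x r; have Ay := l2_y r.
have [Px|nPx] := EM (P x); last by apply: (sat_principal r iP) => c Ac /(Pp _ _ Ax Ac)[].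
have [Py|nPy] := EM (P y); last first.
  by apply: (sat_principal (loc2_sym r) iP) => c Ac /(Pp _ _ Ay Ac)[].
case: nMP => c /(l2_m r)[a [b [Aa Ab ->]]].
by apply: (idD iP); exact: (idMl iP).
Qed.

Lemma nonunit_ideal A x y : loc2 A x y -> proper_ideal A (nonunit A).
Proof.
move=> l; have sA := l2_sub l; split; last exact: nonunit1.
split; [by move=> z [] | exact: nonunit0 | by move=> *; exact: (nonunitD l) |].
by move=> a b Aa nb; rewrite mulrC; exact: nonunitM.
Qed.

(** The primes 0, xA and the nonunits give the lower bound on the dimension. In a longer chain the
    two middle primes are principal, say gA inside hA; writing g = h c, primality puts c into gA and
    makes h a unit. A single generator g of the maximal ideal would divide the prime element x, so g
    would be a unit or y would lie in xA. *)
Lemma rlsp_regular A x y : rlsp A x y -> regular_local_dim2 A.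
Proof.
move=> r; have sA := l2_sub r; have nA := l2_noeth r; have Ax := l2_x r; have Ay := l2_y r.
have pM := nonunit_ideal r; have x0 := rl_x0 r.
have maxM : maximal_ideal A (nonunit A).
  split=> // N pN MN z; split; last exact: MN.
  exact: proper_nonunit.
have prx : prime_ideal A (pid A x).
  split; first split; first exact: pid_ideal.
    by have := @rl_y_nilp A x y 0 r; rewrite expr0.
  move=> a b Aa Ab xab; have [|na] := EM (pid A x a); first by left.
  have [|nb] := EM (pid A x b); [by right | exfalso].
  have [u [e [h [u0 Au Aui Ah aE]]]] := dvr_mod r Aa na.
  have [v [f [k [v0 Av Avi Ak bE]]]] := dvr_mod r Ab nb.
  apply: (@rl_y_nilp A x y (e + f) r); case: xab => d Ad dE.
  exists (u^-1 * v^-1 * (d - u * y ^+ e * k - h * v * y ^+ f - x * h * k)); first by inr.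
  apply: (mulfI u0); apply: (mulfI v0).
  transitivity (a * b - x * (u * y ^+ e * k + h * v * y ^+ f + x * h * k)).
    by rewrite aE bE exprD; ring.
  by rewrite dE; field; rewrite u0 v0.
split=> //.
  split.
    exists (fun z => z = 0), (pid A x), (nonunit A); split=> //.
    - split; first (split; last by move=> /= /eqP; rewrite oner_eq0).
        split; [by move=> z ->; inr | by [] | by move=> a b -> ->; rewrite addr0 |].
        by move=> a b _ ->; rewrite mulr0.
      by move=> a b _ _ /= /eqP; rewrite mulf_eq0 => /orP[]/eqP; [left | right].
    - split=> // a b Aa Ab nab; have [|/(unitP Aa)[a0 Aai]] := EM (nonunit A a); first by left.
      by right; rewrite -(mulKf a0 b) mulrC; exact: nonunitM.
    - split; first by move=> z ->; exists 0; [inr | ring].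
      by move/(_ x) => h; case/eqP: x0; apply: h; exists 1; [inr | ring].
    - split; first by move=> z [a Aa ->]; exact: nonunitM sA (nonunitx r) Aa.
      by move/(_ _ (nonunity r)); have := @rl_y_nilp A x y 1 r; rewrite expr1.
  case=> P0 [P1 [P2 [P3 [prP0 prP1 prP2 prP3 [s01 s12 s23]]]]].
  have ncov P Q : prime_ideal A Q -> strict_sub P Q -> ~ subset_of (nonunit A) P.
    by move=> [pQ _] [_ nQP] MP; apply: nQP => c /(proper_nonunit pQ) /MP.
  have [g Pg gP] := prime_principal r prP1 (ncov _ _ prP2 s12).
  have [h Ph hP] := prime_principal r prP2 (ncov _ _ prP3 s23).
  have g0 : g != 0.
    apply/eqP => g0; case: s01 => _; apply=> c /gP[a _ ->]; rewrite g0 mul0r.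
    by case: prP0 => [[/id0]].
  case: prP1 prP2 => [[iP1 _] pP1] [[iP2 nP2] _]; case: s12 => s12 ns12.
  have [c Ac gE] := hP _ (s12 _ Pg).
  have nh : ~ P1 h by move=> P1h; apply: ns12 => d /hP[a Aa ->]; exact: (idMr iP1).
  have [||/gP[d Ad cE]] := pP1 h c (idS iP2 Ph) Ac; [by rewrite -gE | by [] |].
  apply: nP2; have -> : 1 = h * d by apply: (mulfI g0); rewrite mulr1 {1}gE cE; ring.
  exact: (idMr iP2).
exists (nonunit A); split=> //.
  move=> N [pN Nmax] z; have Nn : subset_of N (nonunit A) by move=> c; exact: proper_nonunit.
  by split=> [/Nn //|nz]; apply/(Nmax _ pM Nn).
split.
  exists [:: x; y]; split=> //; first by case=> [|[|]].
  move=> c; rewrite (l2_m r) (gen_idealE _ _ (sr0 sA)) /=; split; last first.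
    by move=> [a [_ [Aa [b [_ [Ab -> ->]]] ->]]]; exists a, b; rewrite addr0.
  by move=> [a [b [Aa Ab ->]]]; exists a, (b * y); split=> //; exists b, 0; rewrite addr0.
case=> [|g [|]] //= _ sS sM.
  have /sM := nonunitx r; rewrite (gen_idealE _ _ (sr0 sA)) /= => /eqP.
  by rewrite (negPf x0).
have Ag := sS 0%N isT; rewrite /= in Ag.
have mg c : nonunit A c -> pid A g c.
  by move/sM; rewrite (gen_idealE _ _ (sr0 sA)) /= => -[a [_ [Aa -> ->]]]; exists a; rewrite ?addr0 1?mulrC.
have ng : nonunit A g.
  apply/sM/gen_idealE; first by inr.
  by exists 1, 0; split; [inr | | ring].
have [c Ac xE] := mg _ (nonunitx r); have [d Ad yE] := mg _ (nonunity r).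
case: prx => _ prx; have [|[b Ab gE]|[b Ab cE]] := prx g c Ag Ac.
- by exists 1; [inr | rewrite -xE; ring].
- have := @rl_y_nilp A x y 1 r; rewrite expr1; apply.
  by exists (b * d); [inr | rewrite yE gE; ring].
- apply: (nonunit1 sA); have -> : 1 = g * b by apply: (mulfI x0); rewrite mulr1 {1}xE cE; ring.
  exact: nonunitM.
Qed.

End RegularLocalDim2.

(** * Adjoining an element: Hilbert's basis theorem *)

Section Adjunction.
Variable F : fieldType.
Implicit Types (A B I J K M N P V : F -> Prop) (p q : {poly F}).

Definition polyin A p := forall i, A p`_i.

Definition adj A (t z : F) := exists2 p, polyin A p & z = p.[t].

Lemma polyin0 A : A 0 -> polyin A 0.
Proof. by move=> A0 i; rewrite coef0. Qed.

Lemma polyinC A c : A 0 -> A c -> polyin A c%:P.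
Proof. by move=> A0 Ac i; rewrite coefC; case: ifP. Qed.

Lemma polyinD A p q : subring A -> polyin A p -> polyin A q -> polyin A (p + q).
Proof. by move=> sA Ap Aq i; rewrite coefD; apply: srD. Qed.

Lemma polyinB A p q : subring A -> polyin A p -> polyin A q -> polyin A (p - q).
Proof. by move=> sA Ap Aq i; rewrite coefB; apply: srB. Qed.

Lemma polyin_idD A I p q : ideal A I -> polyin I p -> polyin I q -> polyin I (p + q).
Proof. by move=> iI Ap Aq i; rewrite coefD; apply: (idD iI). Qed.

Lemma polyin_idM A I p q : ideal A I -> polyin A p -> polyin I q -> polyin I (p * q).
Proof.
move=> iI Ap Iq i; rewrite coefM; apply: big_ind => [||j _]; first exact: id0 iI.
  by move=> a b; exact: (idD iI).
exact: (idMl iI).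
Qed.

Lemma ring_ideal A : subring A -> ideal A A.
Proof. by move=> sA; split=> // *; inr. Qed.

Lemma polyinM A p q : subring A -> polyin A p -> polyin A q -> polyin A (p * q).
Proof. by move=> sA; apply: polyin_idM; exact: ring_ideal. Qed.

Lemma polyinXn A n : subring A -> polyin A 'X^n.
Proof. by move=> sA i; rewrite coefXn; case: eqP => _; inr. Qed.

Lemma polyinX A : subring A -> polyin A 'X.
Proof. by move=> sA i; rewrite coefX; case: eqP => _; inr. Qed.

Lemma polyin_sub A B p : subset_of A B -> polyin A p -> polyin B p.
Proof. by move=> AB Ap i; exact: AB. Qed.

Lemma polyin_MXC A p c : polyin A (p * 'X + c%:P) -> polyin A p /\ A c.
Proof.
move=> h; split=> [i|]; last by have := h 0%N; rewrite coefD coefMX coefC /= add0r.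
by have := h i.+1; rewrite coefD coefMX coefC /= addr0.
Qed.

Lemma adj_sub A t : subring A -> subring (adj A t).
Proof.
move=> sA; split.
- by exists 0; [apply: polyin0; inr | rewrite horner0].
- by exists 1%:P; [apply: polyinC; inr | rewrite hornerC].
- by move=> _ _ [p Ap ->] [q Aq ->]; exists (p - q); [exact: polyinB | rewrite !hornerE].
- by move=> _ _ [p Ap ->] [q Aq ->]; exists (p * q); [exact: polyinM | rewrite hornerM].
Qed.

Lemma adj_base A t : subring A -> subset_of A (adj A t).
Proof. by move=> sA c Ac; exists c%:P; [apply: polyinC; inr | rewrite hornerC]. Qed.

Lemma adj_gen A t : subring A -> adj A t t.
Proof. by move=> sA; exists 'X; [exact: polyinX | rewrite hornerX]. Qed.

Lemma adj_min A B t : subring B -> subset_of A B -> B t -> subset_of (adj A t) B.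
Proof.
move=> sB AB Bt _ [p Ap ->]; elim/poly_ind: p Ap => [|p c IH].
  by rewrite horner0 => _; inr.
by case/polyin_MXC => /IH h /AB Bc; rewrite hornerMXaddC; inr.
Qed.

(** [d] bounds the number of coefficients, so the degree in t is below [d]. *)
Definition polyle A t d (z : F) := exists p, [/\ polyin A p, (size p <= d)%N & z = p.[t]].

Lemma polyle0 A t d : subring A -> polyle A t d 0.
Proof.
by move=> sA; exists 0; rewrite horner0 size_poly0; split=> //; apply: polyin0; inr.
Qed.

Lemma polyleD A t d z w : subring A ->
  polyle A t d z -> polyle A t d w -> polyle A t d (z + w).
Proof.
move=> sA [p [Ap sp ->]] [q [Aq sq ->]]; exists (p + q).
rewrite hornerD; split=> //; first exact: polyinD.
by rewrite (leq_trans (size_polyD _ _)) // geq_max sp sq.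
Qed.

Lemma polyleM A t d a z : subring A -> A a -> polyle A t d z -> polyle A t d (a * z).
Proof.
move=> sA Aa [q [Aq sq ->]]; exists (a%:P * q); rewrite hornerM hornerC; split=> //.
  by apply: polyinM => //; apply: polyinC; inr.
apply/leq_sizeP => j ltj; rewrite coefCM.
by rewrite (leq_sizeP _ _ sq) ?mulr0.
Qed.

(** The leading coefficient ideals of Hilbert's theorem. They are taken over polynomials, since an
    element of A[t] can be the value of several of them. *)
Definition has_coef A K t d c :=
  exists p, [/\ polyin A p, (size p <= d.+1)%N, p`_d = c & K p.[t]].

Lemma lift_coefs A K t d cs : subring A -> (forall c, c \in cs -> has_coef A K t d c) ->
  exists ks, (forall k, k \in ks -> K k) /\
    forall c, comb A cs c -> has_coef A (comb A ks) t d c.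
Proof.
move=> sA; elim: cs => [|c cs IH] csK.
  exists [::]; split=> // c /= ->; exists 0; split; last by rewrite horner0.
  - by apply: polyin0; inr.
  - by rewrite size_poly0.
  - by rewrite coef0.
have [ks [ksK kP]] := IH (fun c' h => csK c' (mem_behead (s := c :: cs) h)).
have [p [Ap sp pd Kp]] := csK c (mem_head _ _).
exists (p.[t] :: ks); split.
  by move=> k; rewrite in_cons => /orP[/eqP->|/ksK].
move=> _ [a [c' [Aa /kP[q [Aq sq qd cq]] ->]]]; exists (a%:P * p + q); split.
- by apply: polyinD => //; apply: polyinM => //; apply: polyinC; inr.
- apply/leq_sizeP => j ltj; rewrite coefD coefCM.
  by rewrite (leq_sizeP _ _ sp) ?(leq_sizeP _ _ sq) ?mulr0 ?addr0.
- by rewrite coefD coefCM pd qd.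
- by exists a, q.[t]; rewrite !hornerE.
Qed.

Lemma has_coef_ideal A K t d : subring A -> K 0 ->
  (forall a b, K a -> K b -> K (a + b)) -> (forall a z, A a -> K z -> K (a * z)) ->
  ideal A (has_coef A K t d).
Proof.
move=> sA K0 KD KM; split.
- by move=> c [p [Ap _ <- _]].
- exists 0; rewrite size_poly0 coef0 horner0; split=> //.
  by apply: polyin0; inr.
- move=> _ _ [p [Ap sp <- Kp]] [q [Aq sq <- Kq]]; exists (p + q).
  rewrite coefD hornerD; split=> //; [exact: polyinD | | exact: KD].
  by rewrite (leq_trans (size_polyD _ _)) // geq_max sp sq.
- move=> a _ Aa [p [Ap sp <- Kp]]; exists (a%:P * p).
  rewrite coefCM hornerM hornerC; split=> //; [| | exact: KM].
    by apply: polyinM => //; apply: polyinC; inr.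
  apply/leq_sizeP => j ltj; rewrite coefCM.
  by rewrite (leq_sizeP _ _ sp) ?mulr0.
Qed.

Lemma fg_bounded A t d K : subring A -> noetherian A -> K 0 ->
  (forall a b, K a -> K b -> K (a + b)) -> (forall a z, A a -> K z -> K (a * z)) ->
  subset_of K (polyle A t d) ->
  exists s, (forall g, g \in s -> K g) /\ forall z, K z -> comb A s z.
Proof.
move=> sA nA; elim: d K => [|d IH] K K0 KD KM Kd.
  exists [::]; split=> // z /Kd[p [_ sp ->]] /=.
  by move: sp; rewrite leqn0 size_poly_eq0 => /eqP->; rewrite horner0.
have iL := has_coef_ideal t d sA K0 KD KM.
have /(fin_genE sA iL)[cs [csL Lcs]] := nA _ iL.
have [ks [ksK kP]] := lift_coefs sA csL.
pose K' z := K z /\ polyle A t d z.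
have [||||s [sK' K's]] := IH K'.
- by split=> //; exact: polyle0.
- by move=> a b [Ka ha] [Kb hb]; split; [exact: KD | exact: polyleD].
- by move=> a b Aa [Kb hb]; split; [exact: KM | exact: polyleM].
- by move=> z [].
exists (ks ++ s); split=> [g|z Kz].
  by rewrite mem_cat => /orP[/ksK //|/sK' []].
have [p [Ap sp zE]] := Kd _ Kz.
have [|q [Aq sq qd cq]] := kP p`_d; first by apply: Lcs; exists p; rewrite -zE.
have Kq : K q.[t].
  have h g s' : (forall k, k \in s' -> K k) -> comb A s' g -> K g.
    elim: s' g => [|k s' IH'] g s'K /=; first by move=> ->.
    move=> [a [z' [Aa /IH' h ->]]]; apply: KD; first by apply: KM => //; apply: s'K; rewrite mem_head.
    by apply: h => k' k's; apply: s'K; rewrite in_cons k's orbT.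
  exact: h cq.
have -> : z = q.[t] + (p - q).[t] by rewrite hornerD hornerN -zE; ring.
apply: combD => //; first exact: comb_catl.
apply: comb_catr => //; apply: K's; split.
  rewrite hornerD hornerN -zE; apply: KD => //; rewrite -mulN1r; apply: KM => //; by inr.
exists (p - q); split=> //; first exact: polyinB.
apply/leq_sizeP => j; rewrite leq_eqVlt coefB => /orP[/eqP<-|ltj].
  by rewrite qd subrr.
by rewrite (leq_sizeP _ _ sp) ?(leq_sizeP _ _ sq) ?subrr.
Qed.

(** The union of the leading coefficient ideals is finitely generated, hence reached at some n.
    Degrees below n are covered by [fg_bounded]; from degree n on, the leading coefficient is
    cancelled with t^(d-n) times a lifted generator combination. *)
Lemma adj_noetherian A t : subring A -> noetherian A -> noetherian (adj A t).
Proof.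
move=> sA nA I iI; have sB := adj_sub t sA.
apply/(fin_genE sB iI).
have IM a z : A a -> I z -> I (a * z).
  by move=> Aa; apply: (idMl iI); exact: adj_base.
have ID a b := @idD _ _ _ a b iI.
have iL d := has_coef_ideal t d sA (id0 iI) ID IM.
have LS d c k : has_coef A I t d c -> has_coef A I t (d + k) c.
  move=> [p [Ap sp pd Ip]]; exists ('X^k * p); rewrite hornerM hornerXn; split.
  - by apply: polyinM => //; exact: polyinXn.
  - apply/leq_sizeP => j ltj; rewrite coefXnM; case: ltnP => // lekj.
    by rewrite (leq_sizeP _ _ sp) // ltn_subRL addnC.
  - by rewrite coefXnM ltnNge leq_addl /= addnK.
  - apply: (idMl iI) => //; apply: srX => //; exact: adj_gen.
have Lle d d' c : (d <= d')%N -> has_coef A I t d c -> has_coef A I t d' c.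
  by move=> /subnKC <-; exact: LS.
pose L c := exists d, has_coef A I t d c.
have iLL : ideal A L.
  split; first by move=> c [d /(idS (iL d))].
  - by exists 0%N; exact: id0 (iL _).
  - move=> a b [d ha] [d' hb]; exists (maxn d d'); apply: (idD (iL _)).
      exact: Lle (leq_maxl _ _) ha.
    exact: Lle (leq_maxr _ _) hb.
  - by move=> a c Aa [d hc]; exists d; exact: (idMl (iL d)).
have /(fin_genE sA iLL)[cs [csL Lcs]] := nA _ iLL.
have [n nP] : exists n, forall c, c \in cs -> has_coef A I t n c.
  elim: cs csL {Lcs} => [|c cs IH] csL; first by exists 0%N.
  have [n nP] := IH (fun c' h => csL c' (mem_behead (s := c :: cs) h)).
  have [d dc] := csL c (mem_head _ _); exists (maxn d n) => c'.
  rewrite in_cons => /orP[/eqP->|/nP]; first exact: Lle (leq_maxl _ _) dc.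
  exact: Lle (leq_maxr _ _).
have [ks [ksI kP]] := lift_coefs sA nP.
pose K z := I z /\ polyle A t n z.
have [||||s [sK Ks]] := @fg_bounded A t n K sA nA.
- by split; [exact: id0 iI | exact: polyle0].
- by move=> a b [Ka ha] [Kb hb]; split; [exact: ID | exact: polyleD].
- by move=> a b Aa [Kb hb]; split; [exact: IM | exact: polyleM].
- by move=> z [].
exists (ks ++ s); split=> [g|z Iz].
  by rewrite mem_cat => /orP[/ksI //|/sK []].
have [p Ap zE] := idS iI Iz; rewrite {}zE in Iz *.
have [d sp] : exists d, (size p <= d)%N by exists (size p).
elim: d p Ap Iz sp => [|d IH] p Ap Ip sp.
  by move: sp; rewrite leqn0 size_poly_eq0 => /eqP->; rewrite horner0; exact: comb0.
have [ltdn|lend] := ltnP d n.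
  apply: comb_catr => //; apply: comb_sub (adj_base t sA) _; apply: Ks; split=> //.
  by exists p; split=> //; exact: leq_trans sp _.
have [|q [Aq sq qn cq]] := kP p`_d; first by apply: Lcs; exists d, p.
have cq' := comb_sub (adj_base t sA) cq.
have Bt : adj A t (t ^+ (d - n)) by apply: srX => //; exact: adj_gen.
have -> : p.[t] = t ^+ (d - n) * q.[t] + (p - 'X^(d - n) * q).[t].
  by rewrite hornerD hornerN hornerM hornerXn; ring.
apply: combD => //; first by apply: combM => //; exact: comb_catl.
apply: IH.
- by apply: polyinB => //; apply: polyinM => //; exact: polyinXn.
- rewrite hornerD hornerN hornerM hornerXn; apply: (idB sB iI) => //.
  apply: (idMl iI) => //; exact: comb_ideal iI ksI cq'.
- apply/leq_sizeP => j; rewrite leq_eqVlt coefB coefXnM => /orP[/eqP<-|ltj].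
    by rewrite ltnNge leq_subr /= subKn // qn subrr.
  rewrite (leq_sizeP _ _ sp) // ltnNge (leq_trans (leq_subr _ _) (ltnW ltj)) /=.
  by rewrite (leq_sizeP _ _ sq) ?subrr // subnBA // ltn_subRL ltn_add2r.
Qed.

End Adjunction.

(** * Localizations of a quadratic transform *)

Section Localization.
Variable F : fieldType.
Implicit Types (A B I J K M N P V : F -> Prop) (p q : {poly F}).

Definition loc B N : F -> Prop := locz B (fun h => B h /\ ~ N h).

Section Loc.
Variables (B N : F -> Prop).
Hypotheses (sB : subring B) (pN : prime_ideal B N).

Lemma pr_ideal : ideal B N. Proof. by case: pN => [[]]. Qed.
Lemma pr_1 : ~ N 1. Proof. by case: pN => [[]]. Qed.
Lemma pr_M a b : B a -> B b -> ~ N a -> ~ N b -> ~ N (a * b).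
Proof. by move=> Ba Bb na nb; case: pN => _ h /(h _ _ Ba Bb)[]. Qed.
Lemma pr_n0 h : ~ N h -> h != 0.
Proof. by move=> nh; apply/eqP => h0; apply: nh; rewrite h0; exact: id0 pr_ideal. Qed.

Lemma loc_sub : subring (loc B N).
Proof.
have n1 := pr_1; split.
- by exists 0, 1; split; [inr | split; [inr|] | rewrite mul0r].
- by exists 1, 1; split; [inr | split; [inr|] | rewrite divr1].
- move=> _ _ [a [h [Ba [Bh nh] ->]]] [b [k [Bb [Bk nk] ->]]].
  have h0 := pr_n0 nh; have k0 := pr_n0 nk.
  exists (a * k - b * h), (h * k); split; first by inr.
    by split; [inr | exact: pr_M].
  by field; rewrite h0 k0.
- move=> _ _ [a [h [Ba [Bh nh] ->]]] [b [k [Bb [Bk nk] ->]]].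
  have h0 := pr_n0 nh; have k0 := pr_n0 nk.
  exists (a * b), (h * k); split; first by inr.
    by split; [inr | exact: pr_M].
  by field; rewrite h0 k0.
Qed.

Lemma loc_base : subset_of B (loc B N).
Proof.
move=> b Bb; exists b, 1; rewrite divr1; split=> //.
by split; [inr | exact: pr_1].
Qed.

Lemma loc_inv h : B h -> ~ N h -> loc B N h^-1.
Proof. by move=> Bh nh; exists 1, h; rewrite div1r; split=> //; inr. Qed.

Lemma loc_noetherian : noetherian B -> noetherian (loc B N).
Proof.
move=> nB I iI; have sL := loc_sub; apply/(fin_genE sL iI).
pose J z := B z /\ I z.
have iJ : ideal B J.
  split; first by move=> z [].
  - by split; [inr | exact: id0 iI].
  - by move=> a b [Ba Ia] [Bb Ib]; split; [inr | exact: (idD iI)].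
  - by move=> a b Ba [Bb Ib]; split; [inr | apply: (idMl iI) => //; exact: loc_base].
have /(fin_genE sB iJ)[s [sJ Js]] := nB _ iJ.
exists s; split=> [g /sJ []//|z Iz].
have [g [h [Bg [Bh nh] zE]]] := idS iI Iz.
rewrite zE mulrC; apply: combM => //; first exact: loc_inv.
apply: comb_sub loc_base _; apply: Js; split=> //.
have -> : g = z * h by rewrite zE divfK // pr_n0.
by apply: (idMr iI) => //; exact: loc_base.
Qed.

Lemma loc_nonunit c : nonunit (loc B N) c <-> exists n h, [/\ N n, B h, ~ N h & c = n / h].
Proof.
split.
  case=> [[g [h [Bg [Bh nh] cE]]] nc]; exists g, h; split=> //.
  apply: contrapT => ng; case/eqP: (pr_n0 ng).
  have g0 := pr_n0 ng; have h0 := pr_n0 nh.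
  have : c = 0 by apply: nc; exists h, g; split=> //; rewrite cE invf_div.
  by move/eqP; rewrite cE mulf_eq0 invr_eq0 (negPf h0) orbF => /eqP.
move=> [n [h [Nn Bh nh ->]]]; have Bn := idS pr_ideal Nn.
split; first by exists n, h.
rewrite invf_div => -[g [k [Bg [Bk nk] E]]].
have [->|n0] := eqVneq n 0; first by rewrite mul0r.
have h0 := pr_n0 nh; have k0 := pr_n0 nk.
case: (pr_M Bh Bk nh nk); have -> : h * k = g * n.
  by have := congr1 (fun z => z * n * k) E; rewrite /= divfK // => ->; field.
exact: (idMl pr_ideal).
Qed.

End Loc.

(** Top terms with nonunit coefficient are dropped until the leading coefficient is a unit, which
    makes division by the result possible. *)
Lemma trim_lead A x y p : loc2 A x y -> polyin A p -> ~ polyin (nonunit A) p ->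
  exists q, [/\ polyin A q, (size q <= size p)%N, ~ nonunit A (lead_coef q),
    lead_coef q != 0 /\ A (lead_coef q)^-1 & polyin (nonunit A) (p - q)].
Proof.
move=> l; have sA := l2_sub l; have [iM _] := nonunit_ideal l.
have [n sp] : exists n, (size p <= n)%N by exists (size p).
elim: n p sp => [|n IH] p sp Ap np.
  case: np; move: sp; rewrite leqn0 size_poly_eq0 => /eqP ->.
  by apply: polyin0; exact: id0 iM.
have [nl|ul] := EM (nonunit A (lead_coef p)); last first.
  exists p; split=> //; first by apply: unitP => //; rewrite lead_coefE.
  by rewrite subrr; apply: polyin0; exact: id0 iM.
pose m : {poly F} := (lead_coef p)%:P * 'X^((size p).-1).
have mM : polyin (nonunit A) m.
  rewrite /m mulrC; apply: (polyin_idM iM); first exact: polyinXn.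
  by apply: polyinC => //; exact: id0 iM.
have p0 : p != 0 by apply/eqP => p0; apply: np; rewrite p0; apply: polyin0; exact: id0 iM.
have szp : (0 < size p)%N by rewrite size_poly_gt0.
have sz : (size (p - m)%R <= (size p).-1)%N.
  apply/leq_sizeP => j; rewrite leq_eqVlt coefB coefCM coefXn => /orP[/eqP<-|ltj].
    by rewrite eqxx mulr1 lead_coefE subrr.
  by rewrite gtn_eqF // mulr0 subr0 nth_default // -(prednK szp).
have [|||q [Aq sq nq uq dq]] := IH (p - m).
- by rewrite (leq_trans sz) // -ltnS (prednK szp).
- by apply: polyinB => //; apply: polyin_sub mM => c [].
- by move=> h; apply: np; rewrite -(subrK m p); exact: (polyin_idD iM).
exists q; split=> //; first by rewrite (leq_trans sq) // (leq_trans sz) // leq_pred.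
have -> : p - q = p - m - q + m by ring.
exact: (polyin_idD iM).
Qed.

Lemma polyin_div A p g : subring A -> polyin A p -> p != 0 -> A (lead_coef p)^-1 ->
  polyin A g -> exists q r, [/\ polyin A q, polyin A r, (size r < size p)%N & g = q * p + r].
Proof.
move=> sA Ap p0 Ai; have [n] : exists n, (size g <= n)%N by exists (size g).
have szp : (0 < size p)%N by rewrite size_poly_gt0.
have l0 : lead_coef p != 0 by rewrite lead_coef_eq0.
have AP0 : polyin A 0 by apply: polyin0; inr.
elim: n g => [|n IH] g sg Ag.
  exists 0, 0; split=> //; first by rewrite size_poly0.
  by move: sg; rewrite leqn0 size_poly_eq0 => /eqP->; rewrite mul0r addr0.
have [ltn|le_n] := ltnP n (size p).-1.
  exists 0, g; split=> //; last by rewrite mul0r add0r.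
  by rewrite (leq_ltn_trans sg) // -(prednK szp).
pose m : {poly F} := (g`_n * (lead_coef p)^-1)%:P * 'X^(n - (size p).-1).
have Am : polyin A m.
  by apply: polyinM => //; [apply: polyinC; inr; exact: Ag | exact: polyinXn].
have [||q [r [Aq Ar sr E]]] := IH (g - m * p).
- apply/leq_sizeP => j; rewrite /m -mulrA leq_eqVlt coefB coefCM coefXnM => /orP[/eqP<-|ltj].
    by rewrite ltnNge leq_subr /= subKn // -lead_coefE divfK // subrr.
  rewrite (leq_sizeP _ _ sg j) // ltnNge (leq_trans (leq_subr _ _) (ltnW ltj)) /=.
  rewrite [p`_ _]nth_default ?mulr0 ?subrr //.
  by move: szp le_n ltj; case: (size p) => // k _ /=; lia.
- by apply: polyinB => //; exact: polyinM.
exists (q + m), r; split=> //; first exact: polyinD.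
by rewrite mulrDl addrAC -E subrK.
Qed.

(** Gauss's argument: if i and j are the least indices of unit coefficients of p and q, the
    coefficient of index i + j of p q is a unit. *)
Lemma polyin_prime A x y p q : loc2 A x y -> polyin A p -> polyin A q ->
  polyin (nonunit A) (p * q) -> ~ polyin (nonunit A) p -> polyin (nonunit A) q.
Proof.
move=> l Ap Aq pq np; apply: contrapT => nq; have sA := l2_sub l.
have [iM _] := nonunit_ideal l.
have mincoef f : ~ polyin (nonunit A) f ->
    exists i, ~ nonunit A f`_i /\ forall j, (j < i)%N -> nonunit A f`_j.
  move=> /existsNP /nat_minP[i [ni imin]]; exists i; split=> // j ltj.
  by apply: contrapT => /imin; rewrite leqNgt ltj.
have [i [ni imin]] := mincoef _ np; have [j [nj jmin]] := mincoef _ nq.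
have := pq (i + j)%N; rewrite coefM.
have lti : (i < (i + j).+1)%N by rewrite ltnS leq_addr.
rewrite (bigD1 (Ordinal lti)) //= addKn; set S := \sum_(_ < _ | _) _ => h.
have NS : nonunit A S.
  apply: big_ind => [||[k ltk] nek]; [exact: id0 iM | by move=> a b; exact: (idD iM) |].
  rewrite /=; have [ltki|] := ltnP k i; first exact: (idMr iM) (imin _ ltki) (Aq _).
  rewrite leq_eqVlt => /orP[/eqP ik|ltik].
    by case/eqP: nek; apply: val_inj.
  apply: (idMl iM) => //; apply: jmin; rewrite ltn_subLR //.
  by rewrite ltn_add2r.
have : nonunit A (p`_i * q`_j).
  by have := idB sA iM h NS; rewrite addrK.
have [pi0 Api] := unitP (Ap i) ni; move=> npq; apply: nj.
by rewrite -(mulKf pi0 q`_j); apply: (idMl iM).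
Qed.

(** * The chart A[x/y] of the quadratic transform *)

Section BlowUp.
Variables (A : F -> Prop) (x y : F).
Hypothesis r : rlsp A x y.
Let sA := l2_sub r.
Let nA := l2_noeth r.
Let Ax := l2_x r.
Let Ay := l2_y r.
Let x0 := rl_x0 r.
Let y0 := rl_y0 r.
Let t := x / y.

Lemma ty : t * y = x. Proof. by rewrite divfK. Qed.

Lemma polyle_mul k p : polyin A p -> (size p <= k.+1)%N -> A (y ^+ k * p.[t]).
Proof.
elim: k p => [|k IH] p.
  by move=> Ap /size1_polyC ->; rewrite hornerC expr0 mul1r; exact: Ap.
elim/poly_ind: p => [|p c _]; first by rewrite horner0 mulr0 => _ _; inr.
move=> /polyin_MXC[Ap Ac] sp; rewrite hornerMXaddC exprS.
have -> : y * y ^+ k * (p.[t] * t + c) = t * y * (y ^+ k * p.[t]) + y * y ^+ k * c by ring.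
rewrite ty; apply: srD => //; last by inr.
apply: srM => //; apply: IH => //; move: sp; rewrite size_MXaddC.
by case: ifP => // /andP[/eqP-> _]; rewrite size_poly0.
Qed.

Lemma nonunit_y_adj c : nonunit A c -> pid (adj A t) y c.
Proof.
move/(l2_m r) => [a [b [Aa Ab ->]]]; exists (a * t + b); last by rewrite -ty; ring.
have sB := adj_sub t sA; apply: srD => //; last exact: adj_base.
by apply: srM => //; [exact: adj_base | exact: adj_gen].
Qed.

Lemma polyin_y_adj p : polyin (nonunit A) p -> pid (adj A t) y p.[t].
Proof.
have sB := adj_sub t sA; have By := adj_base t sA Ay; have iy := pid_ideal sB By.
elim/poly_ind: p => [|p c IH]; first by rewrite horner0 => _; exact: id0 iy.
move=> /polyin_MXC[/IH Ip Ic]; rewrite hornerMXaddC; apply: (idD iy).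
  by apply: (idMr iy) => //; exact: adj_gen.
exact: nonunit_y_adj.
Qed.

Lemma y_cancel n c : A c -> pid A x (y ^+ n * c) -> pid A x c.
Proof.
move=> Ac; elim: n => [|n IH]; first by rewrite expr0 mul1r.
case=> a Aa; rewrite exprS -mulrA => /(rl_reg r _ Aa) h.
by apply: IH; apply: h; inr.
Qed.

(* The fibre of A[x/y] over the maximal ideal is a polynomial ring over the
   residue field: constant terms are compared modulo x, then divided out. *)
Lemma y_adj_polyin p q : polyin A p -> polyin A q -> p.[t] = y * q.[t] ->
  polyin (nonunit A) p.
Proof.
have [iM _] := nonunit_ideal r.
elim/poly_ind: p q => [|p c IH] q; first by move=> _ _ _; apply: polyin0; exact: id0 iM.
elim/poly_ind: q => [|q d _].
  move=> Ap _; rewrite horner0 mulr0 => E.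
  have [{}Ap Ac] := polyin_MXC Ap.
  have [k Ak cE] : pid A x c.
    apply: (@y_cancel (size p).+1) => //.
    exists (- (y ^+ size p * p.[t])).
      by apply: srN => //; exact: polyle_mul.
    move/eqP: E; rewrite hornerMXaddC addrC addr_eq0 => /eqP ->.
    by rewrite -ty exprS; ring.
  have AP k' : A k' -> polyin A k'%:P by move=> ?; apply: polyinC; inr.
  have pE : p.[t] = y * (- k)%:P.[t].
    have t0 : t != 0 by rewrite mulf_neq0 // invr_eq0.
    apply: (mulIf t0); move/eqP: E; rewrite hornerMXaddC addr_eq0 => /eqP ->.
    by rewrite cE hornerC -ty; ring.
  have hp := IH _ Ap (AP _ (srN sA Ak)) pE.
  move=> i; rewrite coefD coefMX coefC; case: i => [|i] /=; rewrite ?addr0 ?add0r //.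
  by rewrite cE; exact: nonunitM sA (nonunitx r) Ak.
move=> /polyin_MXC[Ap Ac] /polyin_MXC[Aq Ad]; rewrite !hornerMXaddC => E.
have [k Ak cE] : pid A x (c - y * d).
  have Apq : polyin A (y%:P * q - p).
    by apply: polyinB => //; apply: polyinM => //; apply: polyinC; inr.
  (* The [size] factors y clear the denominators of the value at t; the additional one turns t into
     x. *)
  apply: (@y_cancel (size (y%:P * q - p)).+1); first by inr.
  exists (y ^+ size (y%:P * q - p) * (y%:P * q - p).[t]).
    by apply: polyle_mul.
  have -> : c - y * d = t * (y%:P * q - p).[t].
    have -> : c = y * (q.[t] * t + d) - p.[t] * t by rewrite -E; ring.
    by rewrite hornerD hornerN hornerM hornerC; ring.
  by rewrite -ty exprS; ring.
have AP k' : A k' -> polyin A k'%:P by move=> ?; apply: polyinC; inr.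
have pE : p.[t] = y * (q - k%:P).[t].
  have t0 : t != 0 by rewrite mulf_neq0 // invr_eq0.
  apply: (mulIf t0); rewrite hornerD hornerN hornerC.
  have -> : p.[t] * t = y * (q.[t] * t + d) - (c - y * d) - y * d by rewrite -E; ring.
  by rewrite cE -ty; ring.
have hp := IH _ Ap (polyinB sA Aq (AP _ Ak)) pE.
move=> i; rewrite coefD coefMX coefC; case: i => [|i] /=; rewrite ?addr0 ?add0r //.
have -> : c = y * d + x * k by rewrite -cE; ring.
apply: (idD iM); first exact: nonunitM sA (nonunity r) Ad.
exact: nonunitM sA (nonunitx r) Ak.
Qed.

(** Modulo the maximal ideal, A[t] is a polynomial ring over a field, where N becomes a nonzero
    prime. A polynomial p of least size with value in N and some unit coefficient is trimmed to a
    unit leading coefficient; division by it shows that y and p(t) generate N. Since the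
    coefficientwise extension of the maximal ideal to polynomials is prime and p is outside it, p(t)
    is a nonzerodivisor modulo y. *)
Lemma adj_loc_rlsp N : prime_ideal (adj A t) N -> N y ->
  (exists q, [/\ polyin A q, ~ polyin (nonunit A) q & N q.[t]]) ->
  exists w, rlsp (loc (adj A t) N) y w.
Proof.
move=> pN Ny [q0 [Aq0 nq0 Nq0]].
have sB := adj_sub t sA; have nB := @adj_noetherian _ A t sA nA.
have iN := pr_ideal pN; have By := adj_base t sA Ay.
have sL := loc_sub sB pN; have nL := @loc_noetherian _ _ sB pN nB.
have [iM _] := nonunit_ideal r.
have yN z : pid (adj A t) y z -> N z by move=> [b Bb ->]; exact: (idMr iN).
have mN p : polyin (nonunit A) p -> N p.[t] by move=> /polyin_y_adj /yN.
pose Q n := exists q, [/\ polyin A q, ~ polyin (nonunit A) q, N q.[t] & size q = n].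
have [|n [[q [Aq nq Nq sq]] nmin]] := @nat_minP Q.
  by exists (size q0), q0.
have [p [Ap sp nlp [lp0 Alp] dpq]] := trim_lead r Aq nq.
have np : ~ polyin (nonunit A) p by move=> h; apply: nlp; rewrite lead_coefE; exact: h.
have Np : N p.[t].
  have -> : p.[t] = q.[t] - (q - p).[t] by rewrite hornerD hornerN; ring.
  by apply: (idB sB iN) => //; exact: mN.
have p0 : p != 0 by rewrite -lead_coef_eq0.
have pmin g : polyin A g -> N g.[t] -> (size g < size p)%N -> polyin (nonunit A) g.
  move=> Ag Ng sg; apply: contrapT => ng; have : (n <= size g)%N by apply: nmin; exists g.
  by rewrite leqNgt (leq_trans sg) // -sq.
have Bp : adj A t p.[t] by exists p.
have Ngen z : N z -> exists a b, [/\ adj A t a, adj A t b & z = a * y + b * p.[t]].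
  move=> Nz; have [g Ag zE] := idS iN Nz.
  have [q' [s [Aq' As ss gE]]] := polyin_div sA Ap p0 Alp Ag.
  have Bq' : adj A t q'.[t] by exists q'.
  have [|b Bb sE] := @polyin_y_adj s.
    apply: pmin => //; have -> : s.[t] = z - q'.[t] * p.[t].
      by rewrite zE gE hornerD hornerM; ring.
    by apply: (idB sB iN) => //; exact: (idMl iN).
  exists b, q'.[t]; split=> //; rewrite zE gE hornerD hornerM sE; ring.
exists p.[t]; split; [split=> //| exact: y0 |].
- exact: loc_base.
- exact: loc_base.
- move=> c; rewrite (loc_nonunit pN); split.
    move=> [z [h [/Ngen[a [b [Ba Bb ->]]] Bh nh ->]]].
    have Li := loc_inv sB Bh nh.
    exists (a * h^-1), (b * h^-1); split; last by ring.
      by inr; exact: loc_base.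
    by inr; exact: loc_base.
  move=> [a [b [[a' [h [Ba' [Bh nh] ->]]] [b' [k [Bb' [Bk nk] ->]]] ->]]].
  exists (a' * k * y + b' * h * p.[t]), (h * k); split.
  - by apply: (idD iN); apply: (idMl iN) => //; inr.
  - by inr.
  - exact: (pr_M pN).
  - by field; rewrite (pr_n0 pN nh) (pr_n0 pN nk).
- move=> c d [g [h [Bg [Bh nh] cE]]] [g' [h' [Bg' [Bh' nh'] dE]]] E.
  have h0 := pr_n0 pN nh; have h'0 := pr_n0 pN nh'.
  have E' : p.[t] * (g * h') = y * (g' * h).
    have := congr1 (fun z => z * h * h') E; rewrite /= cE dE => E2.
    have -> : p.[t] * (g * h') = p.[t] * (g / h) * h * h' by field; rewrite ?h0 ?h'0.
    by rewrite E2; field; rewrite ?h0 ?h'0.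
  case: (Bg) E' => G AG gE; case: Bh' nh' => H' AH' h'E nh' E'; case: Bg' => G' AG' g'E.
  case: (Bh) => H AH hE.
  have := @y_adj_polyin (p * (G * H')) (G' * H); rewrite !hornerM -gE -h'E -g'E -hE.
  move=> /(_ (polyinM sA Ap (polyinM sA AG AH')) (polyinM sA AG' AH) E') mGH.
  have mGH' := polyin_prime r Ap (polyinM sA AG AH') mGH np.
  rewrite mulrC in mGH'; have mG := polyin_prime r AH' AG mGH'.
  have [|b Bb bE] := @polyin_y_adj G; first by apply: mG => /mN; rewrite -h'E.
  exists (b / h); last by rewrite cE gE bE mulrA.
  by apply: srM => //; [exact: loc_base | exact: loc_inv].
Qed.

End BlowUp.

End Localization.

(** * Minimal valuation overrings *)

Section Valuation.
Variable F : fieldType.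
Implicit Types (A B I J K M N P V W D : F -> Prop) (p q : {poly F}).

(** The ideal of A generated by N, for a fixed set N and a varying ring A. *)
Inductive span N A : F -> Prop :=
| span0 : span N A 0
| spanS n a z : N n -> A a -> span N A z -> span N A (n * a + z).

Lemma spanD N A z w : span N A z -> span N A w -> span N A (z + w).
Proof. by move=> h hw; elim: h => [|n a z' Nn Aa _ IH]; rewrite ?add0r // -addrA; exact: spanS. Qed.

Lemma spanM N A a z : subring A -> A a -> span N A z -> span N A (a * z).
Proof.
move=> sA Aa; elim=> [|n b z' Nn Ab _ IH]; first by rewrite mulr0; exact: span0.
by rewrite mulrDr mulrCA; apply: spanS => //; inr.
Qed.

Lemma span1 N A n a : N n -> A a -> span N A (n * a).
Proof. by move=> Nn Aa; rewrite -[_ * _]addr0; apply: spanS => //; exact: span0. Qed.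

Lemma span_adj N A f z : subring A -> span N (adj A f) z ->
  exists2 p, polyin (span N A) p & z = p.[f].
Proof.
move=> sA; elim=> [|n _ z' Nn [q Aq ->] _ [p Ip ->]].
  by exists 0; [apply: polyin0; exact: span0 | rewrite horner0].
exists (n%:P * q + p); last by rewrite hornerD hornerM hornerC.
by move=> i; rewrite coefD coefCM; apply: spanS.
Qed.

Section Seidenberg.
Variables (A I : F -> Prop).
Hypotheses (sA : subring A) (I0 : I 0) (I1 : ~ I 1) (ID : forall a b, I a -> I b -> I (a + b)).
Hypotheses (IM : forall a b, A a -> I b -> I (a * b)) (IA : subset_of I A).

Let polyinID p q : polyin I p -> polyin I q -> polyin I (p + q).
Proof. by move=> h h' i; rewrite coefD; apply: ID. Qed.

Let polyinIM a p : A a -> polyin I p -> polyin I (a%:P * p).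
Proof. by move=> Aa h i; rewrite coefCM; apply: IM. Qed.

Let rev_poly_at f k q : f != 0 -> polyin I q -> (size q <= k.+1)%N ->
  exists g, [/\ polyin I g, (size g <= k.+1)%N & f ^+ k * q.[f^-1] = g.[f]].
Proof.
move=> f0; elim: k q => [|k IH] q Iq sq.
  by exists q; split=> //; rewrite (size1_polyC sq) !hornerC expr0 mul1r.
elim/poly_ind: q Iq sq => [|q d _] Iq sq.
  by exists 0; rewrite size_poly0 !horner0 mulr0; split=> //; exact: polyin0.
have [Iq' Id] := polyin_MXC Iq.
have [|g [Ig sg gE]] := IH q Iq'.
  by move: sq; rewrite size_MXaddC; case: ifP => // /andP[/eqP-> _]; rewrite size_poly0.
exists (g + d%:P * 'X^(k.+1)); split.
- apply: polyinID => // i; rewrite coefCM coefXn; case: eqP => _; last by rewrite mulr0.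
  by rewrite mulr1.
- rewrite (leq_trans (size_polyD _ _)) // geq_max (leq_trans sg) //=.
  by rewrite mul_polyC (leq_trans (size_scale_leq _ _)) // size_polyXn.
- rewrite hornerMXaddC hornerD hornerM hornerC hornerXn -gE exprS.
  by field.
Qed.

(* Of two relations exhibiting 1 in I A[f] and in I A[1/f], the longer one
   can be shortened using the other. *)
Lemma not_both_one f p q : f != 0 -> polyin I p -> polyin I q ->
  p.[f] = 1 -> q.[f^-1] = 1 -> False.
Proof.
have [l] : exists l, (size p + size q <= l)%N by exists (size p + size q)%N.
elim: l f p q => [|l IH] f p q sN f0 Ip Iq p1 q1.
  have /eqP := p1; move: sN; rewrite leqn0 addn_eq0 size_poly_eq0 => /andP[/eqP-> _].
  by rewrite horner0 eq_sym oner_eq0.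
wlog leqp : f p q f0 Ip Iq p1 q1 sN / (size q <= size p)%N.
  move=> H; have [leqp|/ltnW leqp] := leqP (size q) (size p); first exact: (H f p q).
  by apply: (H f^-1 q p); rewrite ?invr_eq0 ?invrK // addnC.
case sp : (size p) => [|[|n]].
- by have /eqP := p1; move/eqP: sp; rewrite size_poly_eq0 => /eqP->; rewrite horner0 eq_sym oner_eq0.
- apply: I1; have /size1_polyC pE : (size p <= 1)%N by rewrite sp.
  by rewrite -p1 pE hornerC; exact: Ip.
pose c := p`_n.+1; pose p' := p - c%:P * 'X^(n.+1).
have Ip' : polyin I p'.
  move=> i; rewrite coefB coefCM coefXn; have [->|_] := eqVneq i n.+1.
    by rewrite mulr1 subrr.
  by rewrite mulr0 subr0.
have sp' : (size p' <= n.+1)%N.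
  apply/leq_sizeP => j; rewrite leq_eqVlt coefB coefCM coefXn => /orP[/eqP<-|ltj].
    by rewrite eqxx mulr1 subrr.
  by rewrite nth_default ?sp // gtn_eqF // mulr0 subr0.
elim/poly_ind: q Iq q1 sN leqp => [|q d _] Iq q1 sN leqp.
  by have /eqP := q1; rewrite horner0 eq_sym oner_eq0.
have [Iq' Id] := polyin_MXC Iq.
have [|g [Ig sg gE]] := @rev_poly_at f n q f0 Iq'.
  move: leqp; rewrite size_MXaddC sp; case: ifP => // /andP[/eqP-> _]; by rewrite size_poly0.
have fE : f ^+ n.+1 * (1 - d) = g.[f].
  by rewrite -gE -q1 hornerMXaddC exprS; field.
have p'E : p'.[f] = 1 - c * f ^+ n.+1.
  by rewrite -p1 /p' hornerD hornerN hornerM hornerC hornerXn.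
have Ad := IA Id; have Ac : A c by exact/IA/Ip.
(* In 1 = d + (1 - d) p(f) the top term contributes c f^(n+1) (1 - d), which is replaced by c g(f);
   the size of the first polynomial drops below n + 2. *)
apply: (IH f (d%:P + (1 - d)%:P * p' + c%:P * g) (q * 'X + d%:P)) => //.
- rewrite -ltnS; apply: leq_trans sN; rewrite ltn_add2r sp ltnS.
  rewrite (leq_trans (size_polyD _ _)) // geq_max; apply/andP; split; last first.
    by rewrite mul_polyC (leq_trans (size_scale_leq _ _)).
  rewrite (leq_trans (size_polyD _ _)) // geq_max; apply/andP; split.
    by rewrite (leq_trans (size_polyC_leq1 _)).
  by rewrite mul_polyC (leq_trans (size_scale_leq _ _)).
- apply: polyinID; last exact: polyinIM.
  apply: polyinID; first exact: polyinC.
  by apply: polyinIM => //; inr.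
- by rewrite !hornerD !hornerM !hornerC p'E -fE; ring.
Qed.

End Seidenberg.

(** Let A be maximal among the rings over A0 in which N generates a proper ideal. If neither f nor
    1/f were in A, N would generate the unit ideal in both A[f] and A[1/f], which [not_both_one]
    excludes. *)
Lemma chevalley A0 N : subring A0 -> subset_of N A0 -> ~ span N A0 1 ->
  exists W, [/\ valuation_ring W, subset_of A0 W & ~ span N W 1].
Proof.
move=> sA0 NA0 n1.
pose good A := [/\ subring A, subset_of A0 A & ~ span N A 1].
pose Q A := (forall z, ~ A z) \/ good A.
have [C CQ totC|A [QA Amax]] := @classical_sets.Zorn_bigcup F Q.
  pose U := classical_sets.bigcup C id.
  have UP z : U z <-> exists2 A, C A & A z by [].
  have [[A [CA [a Aa]]]|noA] := EM (exists A, C A /\ exists a, A a); last first.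
    by left=> z [A CA Az]; apply: noA; exists A; split=> //; exists z.
  have goodC B b : C B -> B b -> good B by move=> /CQ[h /h|].
  have join z w : U z -> U w -> exists2 B, C B & B z /\ B w.
    move=> [B CB Bz] [B' CB' Bw]; have [s|s] := totC _ _ CB CB'.
      by exists B' => //; split=> //; exact: s.
    by exists B => //; split=> //; exact: s.
  have [sA A0A _] := goodC _ _ CA Aa.
  right; split; first split.
  - by exists A => //; inr.
  - by exists A => //; inr.
  - move=> z w /join h /h[B CB [Bz Bw]]; have [sB _ _] := goodC _ _ CB Bz.
    by exists B => //; inr.
  - move=> z w /join h /h[B CB [Bz Bw]]; have [sB _ _] := goodC _ _ CB Bz.
    by exists B => //; inr.
  - by move=> z /A0A Az; exists A.
  have up z : span N U z -> exists2 B, C B & (exists b, B b) /\ span N B z.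
    elim=> [|n b z' Nn Ub _ [B CB [[b' Bb'] sz']]].
      by exists A => //; split; [exists a | exact: span0].
    have [B' CB' [B'b B'b']] : exists2 B', C B' & B' b /\ subset_of B B'.
      case: Ub => B2 CB2 B2b; have [s|s] := totC _ _ CB CB2.
        by exists B2.
      by exists B => //; split=> //; exact: s.
    exists B' => //; split; first by exists b.
    apply: spanS => //; elim: sz' => [|? ? ? ? ? _ ?]; first exact: span0.
    by apply: spanS => //; exact: B'b'.
  by move=> /up[B CB [[b Bb] s1]]; have [_ _] := goodC _ _ CB Bb; apply.
have [sA A0A nA] : good A.
  case: QA => // eA; case: (Amax A0); last by right; split.
  split=> [z Az|h]; first by case: (eA z).
  by case: (eA 0); apply: h; inr.
exists A; split=> //; split=> // f f0; apply: contrapT => /not_orP[nf nfi].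
have ex g : ~ A g -> exists2 p, polyin (span N A) p & p.[g] = 1.
  move=> ng; have [s|ns] := EM (span N (adj A g) 1).
    by have [p Ip E] := span_adj sA s; exists p.
  case: (Amax (adj A g)); last first.
    right; split=> //; first exact: adj_sub.
    by move=> z /A0A; exact: adj_base.
  split; first exact: adj_base.
  by move=> h; apply: ng; apply: h; exact: adj_gen.
have [p Ip p1] := ex _ nf; have [q Iq q1] := ex _ nfi.
have spA : subset_of (span N A) A.
  move=> z; elim=> [|n a z' /NA0 /A0A Nn Aa _ Az']; by inr.
apply: (@not_both_one A (span N A) sA (span0 _ _) nA _ _ spA f p q) => //.
  exact: spanD.
by move=> a b; exact: spanM.
Qed.

Section ValuationRing.
Variable V : F -> Prop.
Hypothesis vV : valuation_ring V.
Let sV : subring V. Proof. by case: vV. Qed.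

Lemma val_inv f : ~ V f -> nonunit V f^-1.
Proof.
move=> nf; have f0 : f != 0 by apply/eqP => f0; apply: nf; rewrite f0; inr.
case: vV => _ /(_ f f0)[//|Vi]; split=> //; by rewrite invrK.
Qed.

Lemma val_nonunitD a b : nonunit V a -> nonunit V b -> nonunit V (a + b).
Proof.
have H c d : nonunit V c -> c != 0 -> V (d / c) -> nonunit V (c + d).
  move=> nc c0 Vdc; have -> : c + d = c * (1 + d / c) by field.
  by apply: nonunitM => //; inr.
have [->|a0] := eqVneq a 0; first by rewrite add0r.
have [->|b0] := eqVneq b 0; first by rewrite addr0.
move=> na nb; have ab0 : b / a != 0 by rewrite mulf_neq0 // invr_eq0.
case: vV => _ /(_ _ ab0)[|]; first exact: H.
by rewrite invf_div addrC; exact: H.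
Qed.

Definition cent B c := B c /\ nonunit V c.

Lemma cent_prime B : subring B -> subset_of B V -> prime_ideal B (cent B).
Proof.
move=> sB BV; split; first split.
- split; first by move=> z [].
  + by split; [inr | exact: nonunit0].
  + by move=> a b [Ba na] [Bb nb]; split; [inr | exact: val_nonunitD].
  + by move=> a b Ba [Bb nb]; split; [inr | rewrite mulrC; apply: nonunitM => //; exact: BV].
- by move=> [_ /nonunit1]; apply.
- move=> a b Ba Bb [_ nab]; have [na|/(unitP (BV _ Ba))[a0 Vai]] := EM (nonunit V a).
    by left.
  by right; split=> //; rewrite -(mulKf a0 b) mulrC; exact: nonunitM.
Qed.

(** Chevalley's theorem is applied to B + m_V and N = cB + m_V, where m_V is the set of nonunits of
    V. Having m_V in N forces the resulting valuation ring W into V, so W = V by minimality; but c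
    is a unit of V and a nonunit of W. Hence N contains 1. *)
Lemma cent_maximal D B c : minimal_valuation_overring D V -> subring B ->
  subset_of D B -> subset_of B V -> B c -> ~ nonunit V c ->
  exists2 d, B d & nonunit V (1 - c * d).
Proof.
move=> [[_ DV] Vmin] sB DB BV Bc nc.
pose A0 z := exists b v, [/\ B b, nonunit V v & z = b + v].
pose N z := exists b v, [/\ B b, nonunit V v & z = c * b + v].
have nV0 := nonunit0 sV; have mV a b : V a -> nonunit V b -> nonunit V (a * b).
  by rewrite mulrC => *; exact: nonunitM.
have sA0 : subring A0.
  split.
  - by exists 0, 0; split=> //; [inr | rewrite addr0].
  - by exists 1, 0; split=> //; [inr | rewrite addr0].
  - move=> _ _ [b [v [Bb nv ->]]] [b' [v' [Bb' nv' ->]]]; exists (b - b'), (v - v').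
    split; [by inr | | by ring].
    by apply: val_nonunitD => //; rewrite -mulN1r; apply: mV => //; inr.
  - move=> _ _ [b [v [Bb nv ->]]] [b' [v' [Bb' nv' ->]]].
    exists (b * b'), (b * v' + (b' + v') * v); split; [by inr | | by ring].
    have Vv' : V v' by case: nv'.
    by apply: val_nonunitD => //; apply: mV => //; [exact: BV | inr; exact: BV].
have NA0 : subset_of N A0.
  by move=> _ [b [v [Bb nv ->]]]; exists (c * b), v; split=> //; inr.
have [s|ns] := EM (span N A0 1).
  have : N 1.
    elim: s => [|_ _ _ [b [v [Bb nv ->]]] [b' [v' [Bb' nv' ->]]] _ [b2 [v2 [Bb2 nv2 ->]]]].
      by exists 0, 0; split=> //; [inr | ring].
    have Vv' : V v' by case: nv'.
    exists (b * b' + b2), (c * b * v' + (b' + v') * v + v2).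
    split; [by inr | | by ring].
    apply: val_nonunitD => //; apply: val_nonunitD; apply: mV => //.
      by apply: BV; inr.
    by inr; exact: BV.
  move=> [d [v [Bd nv E]]]; exists d => //.
  by have -> : 1 - c * d = v by rewrite E; ring.
have [W [vW A0W nW]] := chevalley sA0 NA0 ns.
have WV : subset_of W V.
  move=> f Wf; apply: contrapT => nf; apply: nW.
  have f0 : f != 0 by apply/eqP => f0; apply: nf; rewrite f0; inr.
  rewrite -(mulVf f0); apply: span1 => //; exists 0, f^-1.
  by split; [inr | exact: val_inv | ring].
have VW : subset_of V W.
  apply: Vmin => //; split=> // z /DB Bz; apply: A0W; exists z, 0.
  by split=> //; rewrite addr0.
have [c0 Vci] := unitP (BV _ Bc) nc; case: nW; rewrite -(divff c0).
apply: span1; last exact: VW.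
by exists 1, 0; split=> //; [inr | ring].
Qed.

End ValuationRing.

End Valuation.

(** * Valuation rings as unions of quadratic transforms *)

Section Union.
Variable F : fieldType.
Implicit Types (A B D I J K M N P V W : F -> Prop) (p q : {poly F}).

Lemma pow_rad A J j x b k : subring A -> ideal A J -> A x -> A b ->
  J j -> J (x ^+ k) -> J ((j + x * b) ^+ k).
Proof.
move=> sA iJ Ax Ab Jj Jx; have Aj := idS iJ Jj.
rewrite -(subrK ((x * b) ^+ k) ((j + x * b) ^+ k)); apply: (idD iJ); last first.
  by rewrite exprMn; apply: (idMr iJ) => //; inr.
rewrite subrXX addrK; apply: (idMr iJ) => //.
by apply: (big_ind A) => [||i _]; [inr | by move=> *; inr | inr].
Qed.

Lemma sum_rad A J u v k l : subring A -> ideal A J -> A u -> A v ->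
  J (u ^+ k) -> J (v ^+ l) -> J ((u + v) ^+ (k + l)).
Proof.
move=> sA iJ Au Av Ju Jv; rewrite exprDn.
apply: (big_ind J) => [||i _]; [exact: id0 iJ | by move=> *; exact: (idD iJ) |].
rewrite -mulr_natl; apply: (idMl iJ).
  by elim: 'C(_, _) => [|n IH]; rewrite ?mulr0n ?mulrS; inr.
have [le_li|lt_il] := leqP l i.
  rewrite -(subnK le_li) exprD mulrA; apply: (idMl iJ) => //; by inr.
have le_k : (k <= k + l - i)%N by rewrite -addnBA ?leq_addr // ltnW.
by rewrite -(subnK le_k) exprD -mulrA mulrCA; apply: (idMr iJ) => //; inr.
Qed.

Definition gen2 A (a b z : F) := exists u v, [/\ A u, A v & z = u * a + v * b].

Lemma gen2_ideal A a b : subring A -> A a -> A b -> ideal A (gen2 A a b).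
Proof.
move=> sA Aa Ab; split.
- by move=> _ [u [v [Au Av ->]]]; inr.
- by exists 0, 0; split; [inr | inr | ring].
- move=> _ _ [u [v [Au Av ->]]] [u' [v' [Au' Av' ->]]]; exists (u + u'), (v + v').
  by split; [inr | inr | ring].
- move=> c _ Ac [u [v [Au Av ->]]]; exists (c * u), (c * v).
  by split; [inr | inr | ring].
Qed.

(** The unit ideal is allowed. *)
Definition primary A I := forall c, nonunit A c -> exists k, I (c ^+ k).

(** By [dvr_mod], some y^e is a unit times c plus a multiple of x, so y is nilpotent modulo J along
    with x. *)
Lemma primary_intro A x y J c k : rlsp A x y -> ideal A J -> J (x ^+ k) -> J c ->
  ~ pid A x c -> primary A J.
Proof.
move=> r iJ Jx Jc nc; have sA := l2_sub r; have Ax := l2_x r; have Ay := l2_y r.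
have [u [e [h [u0 Au Aui Ah cE]]]] := dvr_mod r (idS iJ Jc) nc.
have Jy : J ((y ^+ e) ^+ k).
  have -> : y ^+ e = u^-1 * c + x * (- (u^-1 * h)).
    by rewrite cE mulrDr mulKf //; ring.
  by apply: (pow_rad sA iJ) => //; [inr | exact: (idMl iJ)].
move=> _ /(l2_m r)[a [b [Aa Ab ->]]]; exists (k + e * k)%N.
apply: (sum_rad sA iJ); [by inr | by inr | |].
  by rewrite exprMn; apply: (idMl iJ) => //; inr.
by rewrite exprMn (exprM y); apply: (idMl iJ) => //; inr.
Qed.

(** The saturation of (a0, b0) with respect to x is principal; dividing by its generator leaves a
    pair whose ideal contains a power of x. *)
Lemma primary_fraction A x y f : rlsp A x y -> has_quotient_field A ->
  exists a b, [/\ A a, A b, b != 0, f = a / b & primary A (gen2 A a b)].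
Proof.
move=> r qA; have sA := l2_sub r; have Ax := l2_x r; have Ay := l2_y r.
have [a0 [b0 [Aa0 Ab0 b00 fE]]] := qA f.
pose K c := A c /\ exists j, gen2 A a0 b0 (x ^+ j * c).
have ig := gen2_ideal sA Aa0 Ab0.
have iK : ideal A K.
  split; first by move=> z [].
  - by split; [inr | exists 0%N; rewrite mulr0; exact: id0 ig].
  - move=> a b [Aa [i ha]] [Ab [j hb]]; split; first by inr.
    exists (i + j)%N; rewrite mulrDr; apply: (idD ig).
      by rewrite addnC exprD -mulrA; apply: (idMl ig) => //; inr.
    by rewrite exprD -mulrA; apply: (idMl ig) => //; inr.
  - move=> a b Aa [Ab [j hb]]; split; first by inr.
    by exists j; rewrite mulrCA; exact: (idMl ig).
have [|g [Ag [j hj]] gP] := sat_principal r iK.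
  move=> c Ac [_ [j hj]]; split=> //; exists j.+1.
  by rewrite exprSr -mulrA.
have [|a1 Aa1 aE] := gP a0.
  by split=> //; exists 0%N, 1, 0; split; [inr | inr | ring].
have [|b1 Ab1 bE] := gP b0.
  by split=> //; exists 0%N, 0, 1; split; [inr | inr | ring].
have g0 : g != 0 by apply/eqP => g0; move: b00; rewrite bE g0 mul0r eqxx.
have b10 : b1 != 0 by apply/eqP => b10; move: b00; rewrite bE b10 mulr0 eqxx.
have {}fE : f = a1 / b1 by rewrite fE aE bE; field; rewrite g0 b10.
have {}hj : gen2 A a1 b1 (x ^+ j).
  case: hj => u [v [Au Av E]]; exists u, v; split=> //.
  by apply: (mulIf g0); rewrite E aE bE; ring.
(* Each common factor x that is divided out lowers the exponent j. The process ends when one of a, b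
   is outside xA, or at j = 0, where the ideal is the unit ideal. *)
move: a1 b1 Aa1 Ab1 b10 fE hj {aE bE}; elim: j => [|j IH] a b Aa Ab b0' fE hj.
  exists a, b; split=> // c _; by exists 0%N.
have iab := gen2_ideal sA Aa Ab.
have [[a' Aa' aE]|na] := EM (pid A x a); last first.
  exists a, b; split=> //; apply: (primary_intro r iab hj) na.
  by exists 1, 0; split; [inr | inr | ring].
have [[b' Ab' bE]|nb] := EM (pid A x b); last first.
  exists a, b; split=> //; apply: (primary_intro r iab hj) nb.
  by exists 0, 1; split; [inr | inr | ring].
have x0 := rl_x0 r.
have b'0 : b' != 0 by apply/eqP => b'0; move: b0'; rewrite bE b'0 mulr0 eqxx.
apply: (IH a' b') => //.
  by rewrite fE aE bE; field; rewrite x0 b'0.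
case: hj => u [v [Au Av E]]; exists u, v; split=> //.
by apply: (mulIf x0); rewrite -exprSr E aE bE; ring.
Qed.

Lemma polyleC A t d c : subring A -> A c -> polyle A t d.+1 c.
Proof.
move=> sA Ac; exists c%:P; rewrite hornerC; split=> //; first by apply: polyinC; inr.
by rewrite (leq_trans (size_polyC_leq1 _)).
Qed.

Lemma polyleX A t d z : subring A -> polyle A t d z -> polyle A t d.+1 (z * t).
Proof.
move=> sA [p [Ap sp ->]]; exists (p * 'X); rewrite hornerMX; split=> //.
  by apply: polyinM => //; exact: polyinX.
by rewrite (leq_trans (size_polyMleq _ _)) // size_polyX addnC.
Qed.

Lemma polyle_adj A t d z : polyle A t d z -> adj A t z.
Proof. by move=> [p [Ap _ ->]]; exists p. Qed.

(** * The transform of a primary ideal under one quadratic transform *)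

Section Step.
Variables (A V : F -> Prop) (x y : F).
Let t := x / y.
Let B := adj A t.
Let N := cent V B.
Let A' := loc B N.
Hypotheses (r : rlsp A x y) (vV : valuation_ring V) (AV : subset_of A V) (Vt : V t).
Hypotheses (dom : subset_of (nonunit A) (nonunit V)) (r' : exists w, rlsp A' y w).
Let sA := l2_sub r.
Let Ax := l2_x r.
Let Ay := l2_y r.
Let y0 := rl_y0 r.
Let sV : subring V. Proof. by case: vV. Qed.
Let sB : subring B := adj_sub t sA.
Let BV : subset_of B V := adj_min sV AV Vt.
Let pN : prime_ideal B N := cent_prime vV sB BV.
Let sA' : subring A' := loc_sub sB pN.
Let AB : subset_of A B := adj_base t sA.
Let BA' : subset_of B A' := loc_base sB pN.

(** The k-th power of the maximal ideal: a form of degree k in x and y is y^k times a polynomial of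
    degree at most k in t. *)
Definition mpow k c := exists2 z, polyle A t k.+1 z & c = y ^+ k * z.

Lemma mpow_y k : ~ mpow k.+1 (y ^+ k).
Proof.
move=> [z [p [Ap _ ->]] E].
have /(y_adj_polyin r _ Ap) h : (1%:P : {poly F}).[t] = y * p.[t].
  by rewrite hornerC; apply: (mulfI (expf_neq0 k y0)); rewrite mulr1 {1}E exprS; ring.
have := h _ 0%N; rewrite coefC eqxx => {}h; apply: (nonunit1 sA); apply: h.
by apply: polyinC; inr.
Qed.

(** A coefficient a x + b y equals y (a t + b), so extracting y raises the degree by at most one. *)
Lemma polyle_nonunit s p : polyin (nonunit A) p -> (size p <= s)%N ->
  exists2 z, polyle A t s.+1 z & p.[t] = y * z.
Proof.
elim: s p => [|s IH] p mp sp.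
  exists 0; first exact: polyle0.
  by move: sp; rewrite leqn0 size_poly_eq0 => /eqP->; rewrite horner0 mulr0.
elim/poly_ind: p mp sp => [|p c _] mp sp.
  by exists 0; [exact: polyle0 | rewrite horner0 mulr0].
have [mp' /(l2_m r)[a [b [Aa Ab cE]]]] := polyin_MXC mp.
have [|z zs pE] := IH p mp'.
  by move: sp; rewrite size_MXaddC; case: ifP => // /andP[/eqP-> _]; rewrite size_poly0.
exists (z * t + (a * t + b)); last first.
  by rewrite hornerMXaddC pE cE -(ty r) -/t; ring.
apply: polyleD => //; first exact: polyleX.
apply: polyleD => //; last exact: polyleC.
by apply: polyleX => //; exact: polyleC.
Qed.

Variable I : F -> Prop.
Hypotheses (iI : ideal A I) (I1 : ~ I 1) (prI : primary A I).

Let InM : subset_of I (nonunit A).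
Proof. by move=> c; apply: proper_nonunit. Qed.

(** The order is finite because I contains some y^k, which [mpow_y] keeps out of [mpow k.+1]; it is
    positive because I is proper, hence written s + 1. *)
Lemma order_exists : exists s, subset_of I (mpow s.+1) /\ ~ subset_of I (mpow s.+2).
Proof.
have [k Ik] := prI (nonunity r).
have [|n [nn nmin]] := @nat_minP (fun k => ~ subset_of I (mpow k)).
  by exists k.+1 => h; apply: (@mpow_y k); exact: h.
case: n nn nmin => [|[|n]] nn nmin; last first.
- exists n; split=> //; apply: contrapT => /nmin; by rewrite ltnn.
- case: nn => c /InM /(l2_m r)[a [b [Aa Ab ->]]]; exists (a * t + b); last by rewrite expr1 -(ty r) -/t; ring.
  by apply: polyleD => //; [apply: polyleX => //; exact: polyleC | exact: polyleC].
- case: nn => c /(idS iI) Ac; exists c; last by rewrite expr0 mul1r.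
  exact: polyleC.
Qed.

Variable s : nat.
Hypotheses (Is : subset_of I (mpow s.+1)) (nIs : ~ subset_of I (mpow s.+2)).

(** The extension of I to A', divided by y^(s+1), the power of the exceptional divisor given by the
    order of I. *)
Definition transform c :=
  exists q h, [/\ polyin I q, B h, ~ N h & c = q.[t] / (h * y ^+ s.+1)].

(** The exponent is one less than the order of I. Degree at most s suffices to represent all of A[t]
    modulo the transform, so strict inclusions survive, and the missing factor y makes the pullback
    of the transform larger than I. *)
Definition pullback K c := exists z, [/\ polyle A t s.+1 z, K z & c = y ^+ s * z].

Let ys0 : y ^+ s.+1 != 0 := expf_neq0 s.+1 y0.

Lemma transform_ideal : ideal A' transform.
Proof.
have IX q : polyin I q -> exists2 b, B b & q.[t] = y ^+ s.+1 * b.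
  elim/poly_ind: q => [|q c IH]; first by exists 0; [inr | rewrite horner0 mulr0].
  move=> /polyin_MXC[/IH[b Bb qE] /Is[z /polyle_adj Bz cE]]; exists (b * t + z).
    by apply: srD => //; apply: srM => //; exact: adj_gen.
  by rewrite hornerMXaddC qE cE; ring.
split.
- move=> _ [q [h [Iq Bh nh ->]]]; have [b Bb ->] := IX _ Iq; exists b, h; split=> //.
  by have h0 := pr_n0 pN nh; have := ys0; move: (y ^+ s.+1) => Y Y0; field; rewrite ?h0 ?Y0.
- exists 0, 1; rewrite horner0 mul0r; split=> //; [|by inr | exact: pr_1 pN].
  by apply: polyin0; exact: id0 iI.
- move=> _ _ [q [h [Iq Bh nh ->]]] [q' [h' [Iq' Bh' nh' ->]]].
  have h0 := pr_n0 pN nh; have h'0 := pr_n0 pN nh'.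
  case: (Bh) (Bh') => H AH hE [H' AH' h'E].
  exists (H' * q + H * q'), (h * h'); split.
  + by apply: (polyin_idD iI); exact: (polyin_idM iI).
  + by inr.
  + exact: (pr_M pN).
  + by rewrite hornerD !hornerM -hE -h'E; have := ys0; move: (y ^+ s.+1) => Y Y0; field; rewrite ?h0 ?h'0 ?Y0.
- move=> _ _ [g [k [Bg [Bk nk] ->]]] [q [h [Iq Bh nh ->]]].
  have h0 := pr_n0 pN nh; have k0 := pr_n0 pN nk; case: Bg => G AG gE.
  exists (G * q), (k * h); split; [exact: (polyin_idM iI) | by inr | exact: (pr_M pN) |].
  by rewrite hornerM -gE; have := ys0; move: (y ^+ s.+1) => Y Y0; field; rewrite ?h0 ?k0 ?Y0.
Qed.

Let iJ := transform_ideal.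

Lemma transform_div c : I c -> transform (c / y ^+ s.+1).
Proof.
move=> Ic; exists c%:P, 1; rewrite hornerC mul1r; split=> //; [|by inr | exact: pr_1 pN].
by apply: polyinC => //; exact: id0 iI.
Qed.

Lemma transform_sub c : I c -> transform c.
Proof.
move=> /transform_div h; have -> : c = c / y ^+ s.+1 * y ^+ s.+1 by rewrite divfK.
by apply: (idMr iJ) => //; inr; apply/BA'/AB.
Qed.

Let ypow : exists k, transform (y ^+ k).
Proof. by have [k /transform_sub Ik] := prI (nonunity r); exists k. Qed.

Let lead_form : exists p, [/\ polyin A p, (size p <= s.+2)%N, ~ polyin (nonunit A) p
  & transform p.[t]].
Proof.
move/existsNP: nIs => [a /not_implyP[Ia na]].
have [z [p [Ap sp zE]] aE] := Is Ia; exists p; split=> //.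
  move=> mp; apply: na; have [z' hz' E] := polyle_nonunit mp sp.
  by exists z' => //; rewrite aE zE E mulrA -exprSr.
have -> : p.[t] = a / y ^+ s.+1 by rewrite aE zE mulrC mulKf.
exact: transform_div.
Qed.

(** The transform contains a power of y and the leading form p(t). The latter is outside yA' because
    p and the denominators come from polynomials with a unit coefficient. *)
Lemma transform_primary : primary A' transform.
Proof.
have [w rw] := r'; have [k Jy] := ypow; have [p [Ap sp np Jp]] := lead_form.
apply: (primary_intro rw iJ Jy Jp) => -[_ [g [h [Bg [Bh nh] ->]]] E].
have h0 := pr_n0 pN nh; case: (Bg) (Bh) => G AG gE [H AH hE].
have /(y_adj_polyin r (polyinM sA Ap AH) AG) mpH : (p * H).[t] = y * G.[t].
  by rewrite hornerM E -gE -hE; field.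
have mH := polyin_prime r Ap AH mpH np.
have [b Bb bE] := polyin_y_adj r mH; apply: nh; rewrite hE bE.
by apply: (idMr (pr_ideal pN)) => //; split; [exact: AB | exact/dom/nonunity/r].
Qed.

(* Modulo the transform every element of A[t] is a polynomial of degree at
   most s in t: divide by the leading form, then y is nilpotent. *)
Lemma transform_repr z : B z -> exists z1 j,
  [/\ polyle A t s.+1 z1, transform j & z = z1 + j].
Proof.
have [p [Ap sp np Jp]] := lead_form; have [k Jy] := ypow.
have [p' [Ap' sp' _ [lp0 Alp] dpp]] := trim_lead r Ap np.
have [d Bd dE] := polyin_y_adj r dpp.
have p'0 : p' != 0 by rewrite -lead_coef_eq0.
have base z' : B z' -> exists z1 j b,
    [/\ polyle A t s.+1 z1, transform j, B b & z' = z1 + j + y * b].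
  move=> [g Ag ->]; have [q [u [Aq Au su gE]]] := polyin_div sA Ap' p'0 Alp Ag.
  have Bq : B q.[t] by exists q.
  exists u.[t], (q.[t] * p.[t]), (- (q.[t] * d)); split.
  - by exists u; split=> //; rewrite -ltnS (leq_trans su) // (leq_trans sp').
  - by apply: (idMl iJ) => //; exact: BA'.
  - by inr.
  - have p'E : p'.[t] = p.[t] - y * d by rewrite -dE hornerD hornerN; ring.
    by rewrite gE hornerD hornerM p'E; ring.
move=> Bz; have : exists z1 j b, [/\ polyle A t s.+1 z1, transform j, B b & z = z1 + j + y ^+ k * b].
  elim: {Jy} k => [|k [z1 [j [b [hz1 hj Bb ->]]]]].
    exists 0, 0, z; split=> //; [exact: polyle0 | exact: id0 iJ | by rewrite expr0; ring].
  have [z2 [j2 [b2 [hz2 hj2 Bb2 ->]]]] := base _ Bb.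
  have Ayk : A (y ^+ k) by inr.
  exists (z1 + y ^+ k * z2), (j + y ^+ k * j2), b2; split=> //.
  - by apply: polyleD => //; exact: polyleM.
  - by apply: (idD iJ) => //; apply: (idMl iJ) => //; apply/BA'/AB.
  - by rewrite exprSr; ring.
move=> [z1 [j [b [hz1 hj Bb ->]]]]; exists z1, (j + y ^+ k * b); split=> //; last by ring.
by apply: (idD iJ) => //; apply: (idMr iJ) => //; exact: BA'.
Qed.

Lemma pullback_ideal K : ideal A' K -> ideal A (pullback K).
Proof.
move=> iK; split.
- by move=> _ [z [[p [Ap sp ->]] _ ->]]; exact: (polyle_mul r).
- by exists 0; split; [exact: polyle0 | exact: id0 iK | rewrite mulr0].
- move=> _ _ [z [hz Kz ->]] [z' [hz' Kz' ->]]; exists (z + z').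
  by split; [exact: polyleD | exact: (idD iK) | ring].
- move=> a _ Aa [z [hz Kz ->]]; exists (a * z).
  split; [exact: polyleM | | by ring].
  by apply: (idMl iK) => //; apply/BA'/AB.
Qed.

Lemma pullback_mono K1 K2 : subset_of K1 K2 -> subset_of (pullback K1) (pullback K2).
Proof. by move=> s12 c [z [hz Kz ->]]; exists z; split=> //; exact: s12. Qed.

Lemma pullback_strict K1 K2 : ideal A' K1 -> ideal A' K2 -> subset_of transform K1 ->
  strict_sub K1 K2 -> strict_sub (pullback K1) (pullback K2).
Proof.
move=> iK1 iK2 JK1 [s12 n21]; split; first exact: pullback_mono.
move/existsNP: n21 => [c /not_implyP[K2c nK1c]] sub.
have [g [h [Bg [Bh nh] cE]]] := idS iK2 K2c.
have h0 := pr_n0 pN nh; have [z [j [hz Jj gE]]] := transform_repr Bg.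
have K2g : K2 g by have -> : g = c * h; [rewrite cE divfK | apply: (idMr iK2) => //; exact: BA'].
have K2z : K2 z.
  have -> : z = g - j by rewrite gE; ring.
  by apply: (idB sA' iK2) => //; exact/s12/JK1.
have [|z' [hz' K1z' E]] := sub (y ^+ s * z); first by exists z.
apply: nK1c; rewrite cE; apply: (idMr iK1); last exact: loc_inv.
rewrite gE (mulfI (expf_neq0 s y0) E); apply: (idD iK1) => //; exact: JK1.
Qed.

Lemma polyle_y d z : polyle A t d.+2 z -> polyle A t d.+1 (y * z).
Proof.
move=> [p [Ap sp ->]]; elim/poly_ind: p Ap sp => [|p c _] Ap sp.
  by rewrite horner0 mulr0; exact: polyle0.
have [Ap' Ac] := polyin_MXC Ap; rewrite hornerMXaddC.
have -> : y * (p.[t] * t + c) = x * p.[t] + y * c by rewrite -(ty r) -/t; ring.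
apply: polyleD => //; last by apply: polyleC => //; inr.
apply: polyleM => //; exists p; split=> //.
by move: sp; rewrite size_MXaddC; case: ifP => // /andP[/eqP-> _]; rewrite size_poly0.
Qed.

(** Let j be least with y^(s+j) in I; j is positive since I has order s + 1. Then y^(j-1) = y^(s+j)
    / y^(s+1) is in the transform, so y^(s+j-1) is in the pullback but not in I. *)
Lemma pullback_transform : strict_sub I (pullback transform).
Proof.
split=> [c Ic|sub].
  have [z hz cE] := Is Ic; exists (y * z); split; first exact: polyle_y.
    have -> : y * z = y * (c / y ^+ s.+1) by rewrite cE [y ^+ _ * z]mulrC mulfK.
    by apply: (idMl iJ); [exact/BA'/AB | exact: transform_div].
  by rewrite cE exprSr -mulrA.
have [k Ik] := prI (nonunity r).
have nIy : ~ I (y ^+ s) by move=> /Is; exact: mpow_y.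
have [|j [Ij jmin]] := @nat_minP (fun j => I (y ^+ (s + j))).
  by exists k; rewrite exprD; apply: (idMl iI) => //; inr.
case: j Ij jmin => [|j] Ij jmin; first by rewrite addn0 in Ij.
have : I (y ^+ (s + j)).
  apply: sub; exists (y ^+ j); split; last by rewrite exprD.
    by apply: polyleC => //; inr.
  have -> : y ^+ j = y ^+ (s + j.+1) / y ^+ s.+1.
    by rewrite -addSnnS exprD mulrC mulKf.
  exact: transform_div.
by move/jmin; rewrite ltnn.
Qed.

End Step.

Definition blowup A V t : F -> Prop := loc (adj A t) (cent V (adj A t)).

(** Packages one step for iteration, with m = y^(s+1), J the transform and psi the pullback. The
    clause on K and h expresses that J is generated by the quotients c / m with c in I. *)
Lemma blowup_step A V x y I : rlsp A x y -> valuation_ring V -> subset_of A V ->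
  V (x / y) -> subset_of (nonunit A) (nonunit V) ->
  (exists w, rlsp (blowup A V (x / y)) y w) ->
  ideal A I -> ~ I 1 -> primary A I ->
  let A' := blowup A V (x / y) in
  exists m J psi, [/\ m != 0, ideal A' J /\ primary A' J,
    forall c, I c -> J (c / m),
    forall K h, ideal A' K -> (forall c, I c -> K (h * c)) -> forall c, J c -> K (h * m * c) &
    [/\ forall K, ideal A' K -> ideal A (psi K),
      forall K1 K2, subset_of K1 K2 -> subset_of (psi K1) (psi K2),
      forall K1 K2, ideal A' K1 -> ideal A' K2 -> subset_of J K1 ->
        strict_sub K1 K2 -> strict_sub (psi K1) (psi K2) &
      strict_sub I (psi J)]].
Proof.
move=> r vV AV Vt dom r' iI I1 prI A'.
have [s [Is nIs]] := order_exists r iI I1 prI.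
have sA := l2_sub r; have sV : subring V by case: vV.
have sB := adj_sub (x / y) sA.
have BV : subset_of (adj A (x / y)) V by exact: adj_min.
have pN := cent_prime vV sB BV; have m0 := expf_neq0 s.+1 (rl_y0 r).
exists (y ^+ s.+1), (transform A V x y I s), (pullback A x y s).
split=> //.
- by split; [exact: transform_ideal | exact: transform_primary].
- exact: transform_div.
- move=> K h iK IK _ [q [k [Iq Bk nk ->]]]; have k0 := pr_n0 pN nk.
  have -> : h * y ^+ s.+1 * (q.[x / y] / (k * y ^+ s.+1)) = h * q.[x / y] * k^-1.
    by move: (y ^+ s.+1) m0 => Y Y0; field; rewrite ?k0 ?Y0.
  apply: (idMr iK); last exact: loc_inv.
  elim/poly_ind: q Iq => [|q c IH]; first by rewrite horner0 mulr0 => _; exact: id0 iK.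
  move=> /polyin_MXC[/IH hq /IK hc]; rewrite hornerMXaddC mulrDr mulrA.
  apply: (idD iK) => //; apply: (idMr iK) => //.
  by apply: loc_base => //; exact: adj_gen.
- split.
  + by move=> K; exact: pullback_ideal.
  + by move=> K1 K2; exact: pullback_mono.
  + by move=> K1 K2; exact: pullback_strict.
  + exact: pullback_transform.
Qed.

(* Abhyankar's theorem.  Composing the pullbacks, an element of V outside all
   the A n would give an infinite strictly ascending chain of ideals of A 0. *)
Lemma union_blowups V (A : nat -> F -> Prop) (x y : nat -> F) :
  valuation_ring V -> has_quotient_field (A 0%N) ->
  (forall n, rlsp (A n) (x n) (y n)) -> (forall n, subset_of (A n) V) ->
  (forall n, subset_of (nonunit (A n)) (nonunit V)) ->
  (forall n, V (x n / y n)) -> (forall n, A n.+1 = blowup (A n) V (x n / y n)) ->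
  (forall n, exists w, rlsp (A n.+1) (y n) w) ->
  forall f, V f -> exists n, A n f.
Proof.
move=> vV qA r AV dom Vt AS r' f Vf; apply: contrapT => /forallNP nf.
have sA n := l2_sub (r n).
have [a [b [Aa Ab b0 fE prI0]]] := primary_fraction f (r 0%N) qA.
have A0n n : subset_of (A 0%N) (A n).
  elim: n => // n IH c /IH Ac; rewrite AS.
  have BV : subset_of (adj (A n) (x n / y n)) V by apply: adj_min => //; case: vV.
  have sB := adj_sub (x n / y n) (sA n).
  by apply: loc_base => //; [exact: cent_prime | exact: adj_base].
(* For an ideal I of A n this means that I is the extension of (a, b) divided by h. *)
pose inv n I h := [/\ h != 0, I (a / h), I (b / h)
  & forall c, I c -> gen2 (A n) a b (h * c)].
(* If 1 is in I, then a/h and b/h generate the unit ideal, so one of them is a unit and f or 1/f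
   lies in A n. The first case is excluded by [nf]; in the second 1/f is a nonunit, and domination
   contradicts f in V. *)
have inv_proper n I h : ideal (A n) I -> inv n I h -> ~ I 1.
  move=> iI [h0 Ia Ib hI] /hI; rewrite mulr1 => -[u [v [Au Av hE]]].
  have Aah := idS iI Ia; have Abh := idS iI Ib.
  have bh0 : b / h != 0 by rewrite mulf_neq0 // invr_eq0.
  have fE' : f = a / h * (b / h)^-1 by rewrite fE; field; rewrite h0 b0.
  have [nb|/(unitP Abh)[_ Abi]] := EM (nonunit (A n) (b / h)); last first.
    by apply: (nf n); rewrite fE'; have := sA n; move=> ?; inr.
  have [na|/(unitP Aah)[ah0 Aai]] := EM (nonunit (A n) (a / h)).
    apply: (nonunit1 (sA n)); have -> : 1 = a / h * u + b / h * v.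
      by rewrite -[LHS](divff h0) {1}hE; ring.
    by apply: (nonunitD (r n)); exact: nonunitM.
  have f0 : f != 0 by rewrite fE' mulf_neq0 // invr_eq0.
  have : nonunit (A n) f^-1.
    rewrite fE' invfM invrK mulrC; exact: nonunitM.
  move/dom => [_]; rewrite invrK => /(_ Vf) /eqP; by rewrite invr_eq0 (negPf f0).
(* [phi] is the composite of n pullbacks. A maximal member of this family of ideals of A 0 is
   contradicted by performing one more transform. *)
pose Fam L := exists n I h phi, [/\ ideal (A n) I, primary (A n) I, inv n I h, L = phi I &
  (forall K, ideal (A n) K -> ideal (A 0%N) (phi K)) /\
  forall K1 K2, ideal (A n) K1 -> ideal (A n) K2 -> subset_of I K1 ->
    strict_sub K1 K2 -> strict_sub (phi K1) (phi K2)].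
have [||L [[n [I [h [phi [iI prI ivI LE [phiI phiS]]]]]] Lmax]] :=
  @noeth_max _ (A 0%N) Fam (sA 0%N) (l2_noeth (r 0%N)).
- by move=> L [n [I [h [phi [iI _ _ -> [phiI _]]]]]]; exact: phiI.
- exists (gen2 (A 0%N) a b), 0%N, (gen2 (A 0%N) a b), 1, id; split=> //.
    exact: gen2_ideal.
  have s0 := sA 0%N; split; rewrite ?oner_eq0 ?divr1 //.
  + by exists 1, 0; split; [inr | inr | ring].
  + by exists 0, 1; split; [inr | inr | ring].
  + by move=> c; rewrite mul1r.
have r'n := r' n; rewrite AS in r'n.
have [m [J [psi [m0 [iJ prJ] IJ JK [psiI psiM psiS psiJ]]]]] :=
  blowup_step (r n) vV (@AV n) (Vt n) (@dom n) r'n iI (inv_proper _ _ _ iI ivI) prI.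
have iab n' : ideal (A n') (gen2 (A n') a b) by apply: gen2_ideal => //; exact: A0n.
have [h0 Ia Ib hI] := ivI; move: iJ prJ JK psiI psiS; rewrite -AS => iJ prJ JK psiI psiS.
have [sub nsub] := phiS _ _ iI (psiI _ iJ) (fun _ h => h) psiJ.
apply: nsub; rewrite -LE; apply: Lmax; last by rewrite LE.
exists n.+1, J, (h * m), (phi \o psi); split=> //.
- split; first by rewrite mulf_neq0.
  + by rewrite invfM mulrA; exact: IJ.
  + by rewrite invfM mulrA; exact: IJ.
  + apply: JK => // c /hI[u [v [Au Av ->]]]; exists u, v; split=> //.
      rewrite AS; apply: loc_base; last by apply: adj_base.
        exact: adj_sub.
      by apply: cent_prime => //; [exact: adj_sub | apply: adj_min => //; case: vV].
    rewrite AS; apply: loc_base; last by apply: adj_base.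
      exact: adj_sub.
    by apply: cent_prime => //; [exact: adj_sub | apply: adj_min => //; case: vV].
- split=> [K iK|K1 K2 iK1 iK2 JK1 s12]; first exact/phiI/psiI.
  apply: phiS; [exact: psiI | exact: psiI | | exact: psiS].
  by move=> c /(proj1 psiJ); exact: psiM.
Qed.

End Union.

(** * Construction of the regular local rings alpha_n *)

Section Stages.
Variable F : fieldType.
Implicit Types (A B C D I J K M N P R V W : F -> Prop) (p q : {poly F}).
Implicit Types (U : (F -> Prop) -> Prop).

Lemma loc2_change A x y x' y' : loc2 A x y -> nonunit A x' -> nonunit A y' ->
  gen2 A x' y' x -> gen2 A x' y' y -> loc2 A x' y'.
Proof.
move=> l nx' ny' [u [v [Au Av xE]]] [u' [v' [Au' Av' yE]]]; have sA := l2_sub l.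
split=> //; [exact: l2_noeth l | by case: nx' | by case: ny' |].
move=> c; split=> [/(l2_m l)[a [b [Aa Ab ->]]]|[a [b [Aa Ab ->]]]].
  by exists (a * u + b * u'), (a * v + b * v'); split; [inr | inr | rewrite xE yE; ring].
by apply: (nonunitD l); rewrite mulrC; exact: nonunitM.
Qed.

Definition center_loc V R : F -> Prop := loc R (cent V R).

Section CenterLoc.
Variable V : F -> Prop.
Hypothesis vV : valuation_ring V.
Let sV : subring V. Proof. by case: vV. Qed.

Lemma center_loc_sub R : subring R -> subset_of R V -> subset_of (center_loc V R) V.
Proof.
move=> sR RV _ [a [h [Ra [Rh nh] ->]]].
have [|h0 Vi] := @unitP _ V h (RV _ Rh); first by move=> n; apply: nh.
by inr; exact: RV.
Qed.

Lemma center_loc_dom R : subring R -> subset_of R V ->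
  subset_of (nonunit (center_loc V R)) (nonunit V).
Proof.
move=> sR RV c /(loc_nonunit (cent_prime vV sR RV))[n [h [[Rn nn] Rh nh ->]]].
have [|h0 Vi] := @unitP _ V h (RV _ Rh); first by move=> n'; apply: nh.
exact: nonunitM.
Qed.

Lemma clear_denominators R p : subring R -> subset_of R V -> polyin (center_loc V R) p ->
  exists s, [/\ R s, ~ nonunit V s & polyin R (s%:P * p)].
Proof.
move=> sR RV; have pN := cent_prime vV sR RV.
elim/poly_ind: p => [|p c IH] Ap.
  by exists 1; rewrite mulr0; split; [inr | exact: nonunit1 | apply: polyin0; inr].
have [/IH[s [Rs ns Rsp]] [g [h [Rg [Rh nh] cE]]]] := polyin_MXC Ap.
have h0 := pr_n0 pN nh; exists (s * h); split; first by inr.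
  by move=> nsh; apply: (pr_M pN Rs Rh) => // [[]//|]; split=> //; inr.
have -> : (s * h)%:P * (p * 'X + c%:P) = h%:P * (s%:P * p) * 'X + (s * g)%:P.
  rewrite cE mulrDr -polyCM; congr (_ + _); first by rewrite polyCM; ring.
  by congr (_%:P); field.
have RC a : R a -> polyin R a%:P by move=> ?; apply: polyinC; inr.
apply: polyinD => //; last by apply: RC; inr.
by apply: polyinM; [| apply: polyinM => //; exact: RC | exact: polyinX].
Qed.

(** Coefficients of polynomials over the localization have common denominators that are units of V,
    so localizing before adjoining t changes nothing. *)
Lemma center_loc_adj R t : subring R -> subset_of R V -> V t ->
  center_loc V (adj R t) = blowup (center_loc V R) V t.
Proof.
move=> sR RV Vt; have pN := cent_prime vV sR RV; have sA := loc_sub sR pN.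
have RA : subset_of R (center_loc V R) by exact: loc_base.
have AB : subset_of (adj R t) (adj (center_loc V R) t).
  by move=> _ [p Rp ->]; exists p => // i; exact: RA.
apply/predeqP => c; split=> [[g [h [Bg [Bh nh] ->]]]|[_ [_ [[p Ap ->] [[q Aq ->] nh] ->]]]].
  exists g, h; split; [exact: AB | | by []].
  by split; [exact: AB | move=> [_ n]; apply: nh].
have nq : ~ nonunit V q.[t] by move=> n; apply: nh; split=> //; exists q.
have [s [Rs ns Rsp]] := clear_denominators sR RV Ap.
have [s' [Rs' ns' Rsq]] := clear_denominators sR RV Aq.
have VX := adj_min sV RV Vt.
have VqE : V (s'%:P * q).[t] by apply: VX; exists (s'%:P * q).
have Rsqt : adj R t (s'%:P * q).[t] by exists (s'%:P * q).
have sB := adj_sub t sR; have Bs : adj R t s by exact: adj_base.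
have Bs' : adj R t s' by exact: adj_base.
have [s0 _] := unitP (RV _ Rs) ns; have [s'0 _] := unitP (RV _ Rs') ns'.
have Vq : V q.[t].
  have [s'0' Vi] := unitP (RV _ Rs') ns'.
  have -> : q.[t] = s'^-1 * (s'%:P * q).[t] by rewrite hornerM hornerC mulKf.
  by inr.
have nuM a b : V a -> V b -> ~ nonunit V a -> ~ nonunit V b -> ~ nonunit V (a * b).
  move=> Va Vb na nb nab; apply: nb; have [a0 Vai] := unitP Va na.
  by rewrite -(mulKf a0 b) mulrC; exact: nonunitM.
have [q0 _] := unitP Vq nq.
exists (s' * (s%:P * p).[t]), (s * (s'%:P * q).[t]); split.
- by inr; exists (s%:P * p).
- split; first by inr.
  move=> [_]; rewrite hornerM hornerC; apply: (nuM) => //; [exact: RV | by inr; exact: RV|].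
  by apply: nuM => //; exact: RV.
- by rewrite !hornerM !hornerC; field; rewrite q0 s0 s'0.
Qed.

(** Denominators are units of the localization, so the generators may be taken in R. If x/y is a
    nonunit of V, replacing x by x + y makes the values equal. *)
Lemma equal_value_generators R x1 y1 : subring R -> subset_of R V ->
  regular_local_dim2 (center_loc V R) -> loc2 (center_loc V R) x1 y1 ->
  exists x y, [/\ R x, R y, rlsp (center_loc V R) x y, V (x / y) & V (y / x)].
Proof.
move=> sR RV reg l; have pN := cent_prime vV sR RV; set A := center_loc V R in reg l *.
have sA := l2_sub l; have RA : subset_of R A by exact: loc_base.
have clear z : nonunit A z -> exists s, [/\ R s, A s^-1, s != 0 & R (s * z)].
  move=> [[a [h [Ra [Rh nh] ->]]] _]; have h0 := pr_n0 pN nh.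
  exists h; split=> //; first exact: loc_inv.
  by rewrite mulrC divfK.
have [s [Rs Asi s0 Rx]] := clear _ (nonunitx l); have [s' [Rs' As'i s'0 Ry]] := clear _ (nonunity l).
have l' : loc2 A (s * x1) (s' * y1).
  have nM a b : A a -> nonunit A b -> nonunit A (a * b) by rewrite mulrC => *; exact: nonunitM.
  apply: (loc2_change l).
  - by apply: nM; [exact: RA | exact: nonunitx l].
  - by apply: nM; [exact: RA | exact: nonunity l].
  - by exists s^-1, 0; rewrite mulKf //; split=> //; [inr | ring].
  - by exists 0, s'^-1; rewrite mulKf //; split=> //; [inr | ring].
move: (s * x1) (s' * y1) Rx Ry l' => {}x1 {}y1 Rx Ry {}l.
have H x y : R x -> R y -> loc2 A x y -> V (x / y) ->
  exists x y, [/\ R x, R y, rlsp A x y, V (x / y) & V (y / x)].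
  move=> {}Rx {}Ry lxy Vxy; have rxy := regular_rlsp reg lxy.
  have [x0 y0] : x != 0 /\ y != 0 by split; [exact: rl_x0 rxy | exact: rl_y0 rxy].
  have [Vyx|nyx] := EM (V (y / x)); first by exists x, y.
  have nxy : nonunit V (x / y) by have := val_inv vV nyx; rewrite invf_div.
  have [||u0 Vu] := @unitP _ V (1 + x / y); first by inr.
    move=> n1; apply: (nonunit1 sV); have -> : 1 = (1 + x / y) + (-1) * (x / y) by ring.
    by apply: val_nonunitD => //; rewrite mulrC; apply: nonunitM => //; inr.
  have E : (x + y) / y = 1 + x / y by field.
  exists (x + y), y; split; [by inr | by [] | | by rewrite E; inr | by rewrite -invf_div E].
  apply: (regular_rlsp reg); apply: (loc2_change lxy).
  - by apply: (nonunitD lxy); [exact: nonunitx lxy | exact: nonunity lxy].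
  - exact: nonunity lxy.
  - by exists 1, (-1); split; [inr | inr | ring].
  - by exists 0, 1; split; [inr | inr | ring].
have r1 := regular_rlsp reg l.
have xy0 : x1 / y1 != 0 by rewrite mulf_neq0 ?invr_eq0 ?(rl_x0 r1) ?(rl_y0 r1).
case: vV => _ /(_ _ xy0)[|]; first exact: H.
by rewrite invf_div; apply: H => //; exact: loc2_sym.
Qed.

End CenterLoc.

(* The point of the blowup of A where t = x/y vanishes. *)
Definition origin A t : F -> Prop :=
  loc (adj A t) (fun z => exists p, [/\ polyin A p, nonunit A p`_0 & z = p.[t]]).

Section Origin.
Variables (A : F -> Prop) (x y : F).
Hypothesis r : rlsp A x y.
Let sA := l2_sub r.
Let t := x / y.
Let N z := exists p, [/\ polyin A p, nonunit A p`_0 & z = p.[t]].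

Lemma origin_prime : prime_ideal (adj A t) N.
Proof.
have [iM M1] := nonunit_ideal r.
(* Two polynomials with the same value at t agree modulo the maximal ideal, so the constant term of
   an element of A[t] is well defined there. *)
have eq0 p q : polyin A p -> polyin A q -> p.[t] = q.[t] -> nonunit A p`_0 -> nonunit A q`_0.
  move=> Ap Aq E np.
  have /(y_adj_polyin r (polyinB sA Aq Ap) (polyin0 (sr0 sA))) h : (q - p).[t] = y * (0 : {poly F}).[t].
    by rewrite hornerD hornerN E subrr horner0 mulr0.
  by have := idD iM (h 0%N) np; rewrite coefB subrK.
split; first split.
- split.
  + by move=> _ [p [Ap _ ->]]; exists p.
  + exists 0; rewrite coef0 horner0; split=> //; first by apply: polyin0; inr.
    exact: id0 iM.
  + move=> _ _ [p [Ap np ->]] [q [Aq nq ->]]; exists (p + q).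
    by rewrite coefD hornerD; split=> //; [exact: polyinD | exact: (idD iM)].
  + move=> _ _ [q Aq ->] [p [Ap np ->]]; exists (q * p).
    rewrite hornerM; split=> //; first exact: polyinM.
    by rewrite coefM big_ord1; exact: (idMl iM).
- move=> [p [Ap np E]]; apply: M1; have := @eq0 p 1%:P Ap _ _ np.
  rewrite coefC eqxx hornerC; apply=> //.
  by apply: polyinC; inr.
- move=> _ _ [p Ap ->] [q Aq ->] [s [As ns]]; rewrite -hornerM => /esym E.
  have := eq0 _ _ As (polyinM sA Ap Aq) E ns; rewrite coefM big_ord1 /= => npq.
  have [np|/(unitP (Ap _))[p0 Api]] := EM (nonunit A p`_0); first by left; exists p.
  right; exists q; split=> //; rewrite -(mulKf p0 q`_0); exact: (idMl iM).
Qed.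

Lemma originP : [/\ regular_local_dim2 (origin A t), subset_of (adj A t) (origin A t),
  nonunit (origin A t) t & subset_of (nonunit A) (nonunit (origin A t))].
Proof.
have sB := adj_sub t sA; have pN := origin_prime; have B1 := sr1 sB; have N1 := pr_1 pN.
have Nsub z : N z -> nonunit (origin A t) z.
  by move=> Nz; apply/(loc_nonunit pN); exists z, 1; split=> //; rewrite divr1.
have AN c : nonunit A c -> N c.
  move=> nc; exists c%:P; rewrite coefC eqxx hornerC; split=> //.
  by apply: polyinC; [inr | case: nc].
have XN : N t.
  exists 'X; rewrite coefX hornerX; split=> //; first exact: polyinX.
  exact: nonunit0.
split.
- have [||w rw] := @adj_loc_rlsp _ A x y r N pN; last exact: rlsp_regular rw.
    exact/AN/nonunity/r.
  exists 'X; split; [exact: polyinX | | by rewrite hornerX].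
  by move/(_ 1%N); rewrite coefX => /(nonunit1 sA).
- exact: loc_base.
- exact: Nsub.
- by move=> c /AN; exact: Nsub.
Qed.

End Origin.

(** * Choice of the quadratic transforms and of the rings alpha *)

Section MinimalOverring.
Variables (D V : F -> Prop).
Hypothesis minV : minimal_valuation_overring D V.
Let vV : valuation_ring V. Proof. by case: minV => [[]]. Qed.
Let sV : subring V. Proof. by case: vV. Qed.

(** [U] collects the rings alpha built so far, and [e] separates V from all of them at once: it is 1
    modulo the maximal ideal of V and lies in the maximal ideal of each member of [U]. *)
Definition stage R (e : F) U :=
  [/\ subring R, subset_of D R, subset_of R V & regular_local_dim2 (center_loc V R)] /\
  [/\ R e, nonunit V (1 - e) &
    forall alpha, U alpha -> [/\ QD D alpha, subset_of R alpha & nonunit alpha e]].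

Lemma next_stage R e U : stage R e U ->
  exists x y alpha e', let t := x / y in
  [/\ rlsp (center_loc V R) x y /\ V t, QD D alpha,
    subset_of (nonunit (center_loc V R)) (nonunit alpha),
    exists w, rlsp (center_loc V (adj R t)) y w &
    stage (adj R t) e' (fun beta => U beta \/ beta = alpha)].
Proof.
move=> [[sR DR RV reg] [Re ne hU]]; have pN := cent_prime vV sR RV.
have dom := center_loc_dom vV sR RV.
have [x1 [y1 l1]] := regular_loc2 reg.
have [x3 [y3 [Rx3 Ry3 r3 Vxy Vyx]]] := equal_value_generators vV sR RV reg l1.
set A := center_loc V R in reg l1 r3 dom *.
have sA := l2_sub r3; have RA : subset_of R A by exact: loc_base.
have x30 := rl_x0 r3; have y30 := rl_y0 r3.
have ue : ~ nonunit V e.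
  move=> n; apply: (nonunit1 sV); have -> : 1 = (1 - e) + e by rewrite subrK.
  exact: val_nonunitD.
have [e0 Vei] := unitP (RV _ Re) ue.
have Aei : A e^-1 by apply: loc_inv => // -[].
set d := 1 - e in ne; have Rd : R d by rewrite /d; inr.
have nd : nonunit A d.
  by apply/(loc_nonunit pN); exists d, 1; rewrite divr1; split=> //; [inr | exact: pr_1 pN].
have [a [b [Aa Ab dE]]] := (proj1 (l2_m r3 _)) nd.
have AV : subset_of A V by exact: (center_loc_sub vV).
(* In an earlier ring beta, e is a nonunit and d = 1 - e a unit, so y is a unit and x is not. In A,
   d = a x3 + b y3 gives y = d a x3 + (e + d b) y3 with e + d b a unit, so x and y still generate.
   The square matters: with d alone this coefficient would be e + b. *)
pose x := e * x3; pose y := e * y3 + d ^+ 2.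
have Rx : R x by rewrite /x; inr.
have Ry : R y by rewrite /y; inr.
have l : loc2 A x y.
  have Ae := RA _ Re; have Ad := RA _ Rd.
  have [||u0 Au] := @unitP _ A (e + d * b); first by inr.
    move=> n; apply: ue; apply: dom; have -> : e = (e + d * b) + d * (- b) by ring.
    by apply: (nonunitD r3) => //; apply: nonunitM => //; inr.
  apply: (loc2_change r3).
  - by rewrite /x mulrC; apply: nonunitM => //; exact: nonunitx r3.
  - apply: (nonunitD r3); last by rewrite expr2; exact: nonunitM.
    by rewrite mulrC; apply: nonunitM => //; exact: nonunity r3.
  - by exists e^-1, 0; rewrite /x mulKf //; split=> //; [inr | ring].
  - exists (- ((e + d * b)^-1 * d * a * e^-1)), (e + d * b)^-1; split; [by inr | by inr |].
    apply: (mulfI u0); rewrite /x.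
    have -> : (e + d * b) * (- ((e + d * b)^-1 * d * a / e) * (e * x3) + (e + d * b)^-1 * y)
      = y - d * a * x3 by field; rewrite u0 e0.
    by rewrite /y expr2 {2}dE; ring.
have r := regular_rlsp reg l; have x0 := rl_x0 r; have y0 := rl_y0 r.
have Vd : V d by exact: RV.
have [Vt Vti] : V (x / y) /\ V (x / y)^-1.
  have Vdy : V (d / y3).
    have -> : d / y3 = a * (x3 / y3) + b by rewrite dE; field.
    by inr; exact: AV.
  have wE : y / y3 = e + d * (d / y3) by rewrite /y; field.
  have Vw : V (y / y3) by rewrite wE; inr; exact: RV.
  have [|w0 Vwi] := unitP Vw.
    rewrite wE => n; apply: ue; have -> : e = (e + d * (d / y3)) + d * (- (d / y3)) by ring.
    by apply: val_nonunitD => //; apply: nonunitM => //; inr.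
  split.
    have -> : x / y = e * (x3 / y3) * (y / y3)^-1 by rewrite /x; field; rewrite ?y0 ?y30.
    by inr; exact: RV.
  have -> : (x / y)^-1 = (y / y3) * (y3 / x3) * e^-1.
    by rewrite /x; field; rewrite ?y0 ?y30 ?x30 ?e0.
  by inr.
set t := x / y in Vt Vti.
have t0 : t != 0 by rewrite mulf_neq0 // invr_eq0.
have nt : ~ nonunit V t by exact: unitPn.
have sR' := adj_sub t sR; have R'V := adj_min sV RV Vt.
have DR' : subset_of D (adj R t) by move=> c /DR; exact: adj_base.
(* The next separating element is t f: it is 1 modulo the maximal ideal of V, and a nonunit wherever
   t is. *)
have [f R'f nf] := cent_maximal vV minV sR' DR' R'V (adj_gen t sR) nt.
have locE := center_loc_adj vV sR RV Vt; rewrite -/A in locE.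
have sB := adj_sub t sA; have BV := adj_min sV AV Vt.
have AB : subset_of A (adj A t) by exact: adj_base.
have pB := cent_prime vV sB BV.
(* The center on A[t] is maximal and misses t, so it contains some 1 - t q(t), the value of a
   polynomial with constant term 1. *)
have [||w rw] := @adj_loc_rlsp _ A x y r (cent V (adj A t)) pB.
- by split; [apply: AB; exact: l2_y r | exact/dom/nonunity/r].
- have DB : subset_of D (adj A t) by move=> c /DR /RA; exact: AB.
  have [_ [q Aq ->] nq] := cent_maximal vV minV sB DB BV (adj_gen t sA) nt.
  have A1q : polyin A (1%:P - 'X * q).
    by apply: polyinB => //; [apply: polyinC; inr | apply: polyinM => //; exact: polyinX].
  have E : (1%:P - 'X * q).[x / y] = 1 - t * q.[t] by rewrite hornerD hornerN hornerM hornerX hornerC.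
  exists (1%:P - 'X * q); split=> //; last first.
    by rewrite E; split=> //; rewrite -E; exists (1%:P - 'X * q).
  by move/(_ 0%N); rewrite coefB coefC coefXM eqxx subr0 => /(nonunit1 sA).
have [regO BO nOt AO] := originP r; rewrite -/t in regO BO nOt AO.
have QO : QD D (origin A t) by split=> // c /DR /RA /AB /BO.
have RtA : subset_of (adj R t) (adj A t).
  by move=> _ [p Rp ->]; exists p => // i; exact: RA.
exists x, y, (origin A t), (t * f); split=> //.
  by exists w; rewrite -/t locE.
split; first by split=> //; rewrite -/t locE; exact: rlsp_regular rw.
split=> //; first by apply: srM => //; exact: adj_gen.
move=> beta [Ub|->]; last first.
  split=> //; first by move=> c /RtA /BO.
  by apply: nonunitM => //; [case: regO | exact/BO/RtA].
have [Qb Rb neb] := hU _ Ub; have [_ regb] := Qb; have sb : subring beta by case: regb.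
have [xb [yb lb]] := regular_loc2 regb.
have [|d0 bdi] := @unitP _ beta d (Rb _ Rd).
  move=> n; apply: (nonunit1 sb); have -> : 1 = d + e by rewrite /d subrK.
  exact: (nonunitD lb).
have [|_ byi] := @unitP _ beta y (Rb _ Ry).
  move=> n; apply: (nonunit1 sb).
  have -> : 1 = (y + e * (- y3)) * (d^-1 * d^-1) by rewrite /y; field.
  apply: nonunitM => //; last by inr.
  by apply: (nonunitD lb) => //; apply: nonunitM => //; inr; exact: Rb.
have nbt : nonunit beta t.
  have -> : t = e * (x3 * y^-1) by rewrite /t /x mulrA.
  by apply: nonunitM => //; inr; exact: Rb.
have R'b : subset_of (adj R t) beta by apply: adj_min => //; case: nbt.
by split=> //; apply: nonunitM => //; exact: R'b.
Qed.

(** A nonunit h of D outside the center would have 1 - h d in the center for some d, although 1 - h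
    d is a unit of D. *)
Lemma center_loc_base : regular_local_dim2 D -> center_loc V D = D.
Proof.
move=> reg; have sD : subring D by case: reg.
have DV : subset_of D V by case: minV => [[]].
have [x [y l]] := regular_loc2 reg.
apply/predeqP => c; split; last by apply: loc_base => //; exact: cent_prime.
move=> [a [h [Da [Dh nh] ->]]]; have nh' : ~ nonunit V h by move=> n; apply: nh.
apply: srM => //.
have [nDh|/(unitP Dh)[]//] := EM (nonunit D h).
have [d Dd [_ n]] := cent_maximal vV minV sD (fun _ h => h) DV Dh nh'.
have [u0 Du] := unit1B l nDh Dd.
by have := n (DV _ Du); move/eqP; rewrite (negPf u0).
Qed.

End MinimalOverring.

(** Some component [w i] omits 1/x, and V equals it. For c in [w i] but not in V, c is a unit of
    [w i] and x has positive value there, so every x c^n lies in V; a component omitting c bounds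
    n. *)
Lemma krull_valuation_DVR V W x : valuation_ring V -> x != 0 -> nonunit V x ->
  same V W -> krull_domain W -> DVR V.
Proof.
move=> vV x0 nx VW [I [w [dw wE _]]].
have VE c : V c <-> forall i, w i c by rewrite (VW c) wE.
have [i nwi] : exists i, ~ w i x^-1.
  apply/existsNP => /VE Vx; case: nx => _ /(_ Vx) /eqP; by rewrite (negPf x0).
suff h c : V c <-> w i c.
  case: (dw i) => v [v1 v2 v3 v4]; exists v; split=> // c; by rewrite h v4.
split=> [/VE //|wic]; apply: contrapT => nVc.
have c0 : c != 0 by apply/eqP => c0; apply: nVc; rewrite c0; case: vV => /sr0.
have [Vci _] := val_inv vV nVc.
have vinv (v : F -> int) : (forall a b, a != 0 -> b != 0 -> v (a * b) = v a + v b) ->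
    forall a, a != 0 -> v a^-1 = - v a.
  move=> vM a a0; have ai0 : a^-1 != 0 by rewrite invr_eq0.
  have := vM 1 1 (oner_neq0 _) (oner_neq0 _); have := vM _ _ a0 ai0.
  by rewrite divff // mulr1; lia.
have xc n : V (x * c ^+ n).
  have xcn0 : x * c ^+ n != 0 by rewrite mulf_neq0 // expf_neq0.
  case: vV => _ /(_ _ xcn0)[//|/VE /(_ i)].
  case: (dw i) => v [vM _ _ vE].
  have vx : 0 < v x.
    rewrite ltNge; apply/negP => vx; apply: nwi; apply/vE; right; rewrite vinv //.
    by rewrite oppr_ge0.
  have vc : v c = 0.
    have /vE[/eqP|h1] := wic; first by rewrite (negPf c0).
    have /VE /(_ i) /vE[/eqP|] := Vci; first by rewrite invr_eq0 (negPf c0).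
    rewrite vinv // => h2; lia.
  have vn : v (x * c ^+ n) = v x.
    elim: n {xcn0} => [|n IH]; first by rewrite expr0 mulr1.
    rewrite exprSr mulrA vM ?IH ?vc ?addr0 // mulf_neq0 // expf_neq0 //.
  move/vE => [/eqP|]; first by rewrite invr_eq0 (negPf xcn0).
  by rewrite vinv // vn; lia.
have [j nwj] : exists j, ~ w j c by apply/existsNP => /VE.
case: (dw j) => v [vM _ _ vE].
have vc : v c < 0 by rewrite ltNge; apply/negP => h; apply: nwj; apply/vE; right.
have vn n : v (x * c ^+ n) <= v x - n%:Z.
  elim: n => [|n IH]; first by rewrite expr0 mulr1 subr0.
  rewrite exprSr mulrA vM //; first by lia.
  by rewrite mulf_neq0 // expf_neq0.
have /VE /(_ j) /vE[/eqP|] := xc `|v x|.+1; last by have := vn `|v x|.+1; lia.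
by rewrite mulf_eq0 (negPf x0) expf_eq0 (negPf c0) andbF.
Qed.

End Stages.

Theorem theorem6p8 (F : fieldType) (D V : F -> Prop) :
  has_quotient_field D ->
  regular_local_dim2 D ->
  minimal_valuation_overring D V ->
  exists U : (F -> Prop) -> Prop,
    (forall alpha, U alpha -> QD D alpha) /\
    let C := fun x : F => forall alpha, U alpha -> alpha x in
    is_localization_of C V /\ (~ DVR V -> ~ almost_krull C).
Proof.
move=> qD reg minV; have [[vV DV] _] := minV.
have sV : subring V by case: vV.
have sD : subring D by case: reg.
pose T := {s : (F -> Prop) * F * ((F -> Prop) -> Prop) | stage D V s.1.1 s.1.2 s.2}.
pose R (s : T) := (sval s).1.1; pose U (s : T) := (sval s).2.
pose rel (s : T) (o : F * F * (F -> Prop) * T) :=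
  let: (x, y, alpha, s') := o in
  [/\ rlsp (center_loc V (R s)) x y /\ V (x / y),
    subset_of (nonunit (center_loc V (R s))) (nonunit alpha) /\ U s' alpha,
    exists w, rlsp (center_loc V (R s')) y w,
    R s' = adj (R s) (x / y) & forall beta, U s beta -> U s' beta].
have next s : exists o, rel s o.
  case: s => [[[R0 e] U0] st].
  have [x [y [alpha [e' [rV Qa dom rw st']]]]] := next_stage minV st.
  exists (x, y, alpha, exist _ (adj R0 (x / y), e', fun beta => U0 beta \/ beta = alpha) st').
  by split=> //; [split=> //; right | left].
case: (choice next) => nx nxP.
(* With no ring alpha chosen yet, e = 1 separates trivially. *)
have st0 : stage D V D 1 (fun=> False).
  split; first by split=> //; rewrite (center_loc_base minV).
  by split=> //; [inr | rewrite subrr; exact: nonunit0].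
pose S n := iter n (fun s => (nx s).2) (exist _ (D, 1, fun=> False) st0 : T).
have stS n : stage D V (R (S n)) (sval (S n)).1.2 (U (S n)) by rewrite /R /U; case: (S n).
pose x n := (nx (S n)).1.1.1; pose y n := (nx (S n)).1.1.2; pose al n := (nx (S n)).1.2.
have SP n : rel (S n) (x n, y n, al n, S n.+1).
  by have := nxP (S n); rewrite /x /y /al /=; case: (nx (S n)) => [[[? ?] ?] ?].
pose A n := center_loc V (R (S n)).
have sR n : subring (R (S n)) by case: (stS n) => [[]].
have RV n : subset_of (R (S n)) V by case: (stS n) => [[]].
have Rmono n k : subset_of (R (S n)) (R (S (n + k)%N)).
  elim: k => [|k IH] c; rewrite ?addn0 // addnS => /IH Rc.
  by case: (SP (n + k)%N) => _ _ _ -> _; exact: adj_base.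
have Umono n k beta : U (S n) beta -> U (S (n + k)%N) beta.
  elim: k => [|k IH]; rewrite ?addn0 // addnS => /IH.
  by case: (SP (n + k)%N) => _ _ _ _; exact.
have A0 : A 0%N = D by exact: center_loc_base.
have VA f : V f -> exists n, A n f.
  apply: (@union_blowups F V A x y) => //.
  - by rewrite A0.
  - by move=> n; case: (SP n) => [[]].
  - by move=> n; exact: (center_loc_sub vV).
  - by move=> n; exact: (center_loc_dom vV).
  - by move=> n; case: (SP n) => [[]].
  - by move=> n; rewrite /A; case: (SP n) => [[_ Vt] _ _ -> _]; exact: (center_loc_adj vV).
  - by move=> n; case: (SP n).
pose UU beta := exists n, U (S n) beta.
have UQ beta : UU beta -> QD D beta by move=> [n Ub]; case: (stS n) => _ [_ _ /(_ _ Ub)[]].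
exists UU; split=> //; set C := fun x : F => _; rewrite /=.
(* A ring alpha present at stage m is still present at stage n + m, where it contains R (S (n + m))
   and hence R (S n). *)
have RC n : subset_of (R (S n)) C.
  move=> c Rc beta [m Ub]; case: (stS (n + m)%N) => _ [_ _ /(_ beta)[|_ Rb _]].
    by rewrite addnC; exact: Umono.
  by apply: Rb; exact: Rmono.
(* If f is not in V, then 1/f is a nonunit of some A n, hence of [al n], which therefore omits f;
   [al n] joins the family at stage n + 1. *)
have CV : subset_of C V.
  move=> f Cf; apply: contrapT => nVf.
  have nf := val_inv vV nVf; have [n Afi] := VA _ (proj1 nf).
  have f0 : f != 0 by apply/eqP => f0; apply: nVf; rewrite f0; inr.
  have nAfi : nonunit (A n) f^-1.
    split=> // Af; case: nVf; rewrite -(invrK f); exact: (center_loc_sub vV (sR n) (@RV n)).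
  case: (SP n) => _ [dom Ua] _ _ _; have [_] := dom _ nAfi.
  rewrite invrK => /(_ (Cf _ (ex_intro _ n.+1 Ua))) /eqP.
  by rewrite invr_eq0 (negPf f0).
have sC : subring C.
  have sU beta : UU beta -> subring beta by move=> /UQ[_ []].
  split.
  - by move=> beta /sU; exact: sr0.
  - by move=> beta /sU; exact: sr1.
  - by move=> a b Ca Cb beta Ub; apply: srB; [exact: sU | exact: Ca | exact: Cb].
  - by move=> a b Ca Cb beta Ub; apply: srM; [exact: sU | exact: Ca | exact: Cb].
have pC := cent_prime vV sC CV.
have VC : same V (loc C (cent V C)).
  move=> f; split; last exact: (center_loc_sub vV).
  move=> /VA[n [a [h [Ra [Rh nh] ->]]]]; exists a, h; split=> //; first exact: RC Ra.
  split; first exact: RC Rh.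
  by move=> [_ n']; apply: nh.
split.
  exists (fun h => C h /\ ~ cent V C h); split=> //; split.
  - by move=> c [].
  - by split; [exact: sr1 | exact: pr_1 pC].
  - by move=> [_]; apply; exact: id0 (pr_ideal pC).
  - by move=> a b [Ca na] [Cb nb]; split; [exact: (srM sC Ca Cb) | exact: (pr_M pC)].
move=> nDVR aK; apply: nDVR.
have [[r0 _] _ _ _ _] := SP 0%N.
apply: (krull_valuation_DVR vV (rl_x0 r0) _ VC (aK _ pC)).
exact: (center_loc_dom vV) (sR 0%N) (@RV 0%N) _ (nonunitx r0).
Qed.
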